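(* Let $\Theta\subset\mathbb{R}^d$ be compact and let $p_0$ be any probability density on $\mathbb{R}^d$. Let $\sigma>0$, let $G_\sigma$ be the projection mixing measure of $p_0$ with connected-component decomposition $G_\sigma=\sum_{k=1}^{N_\sigma}\lambda_{\sigma,k}G_{\sigma,k}$, and let $f_{\sigma,k}=\phi_\sigma\ast G_{\sigma,k}$. Let $\widehat{G}_{n,\sigma}$ be the NPMLE based on $n$ i.i.d. samples from $p_0$, and let $\widehat{\lambda}_{n,\sigma,k}$, $\widehat{f}_{n,\sigma,k}$ ($k=1,\ldots,N_\sigma$) be the estimators defined in the context, constructed with a bandwidth $\delta_n>0$ and a threshold $t_n>0$ satisfying $$\delta_n\to0,\qquad t_n\to0,\qquad t_n\ge 2^{-d}\,\delta_n^{-(d+1)}\,d^{-1/2}\,W_1(\widehat{G}_{n,\sigma},G_\sigma).$$ Then $$\max_{k}\Big[|\widehat{\lambda}_{n,\sigma,k}-\lambda_{\sigma,k}|\vee\|\widehat{f}_{n,\sigma,k}-f_{\sigma,k}\|_1\Big]\to0\quad\text{almost surely as } n\to\infty.$$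
   Context: Notation. $\mathcal{P}(\Theta)$ is the set of probability measures supported on $\Theta$; $\phi_\sigma$ is the density of $\mathcal{N}(0,\sigma^2I_d)$; $(\phi_\sigma\ast G)(x)=\int\phi_\sigma(x-\theta)\,dG(\theta)$; $W_1$ is the 1-Wasserstein distance (Euclidean cost); $\|\cdot\|_1$ is the $L^1(\mathbb{R}^d)$ norm; $a\vee b=\max(a,b)$; $\mathrm{dist}(A,B)=\inf_{x\in A,y\in B}|x-y|$ and $\mathrm{dist}(x,B)=\mathrm{dist}(\{x\},B)$. Projection. $G_\sigma\in\mathcal{P}(\Theta)$ is the unique measure such that $p_\sigma=\phi_\sigma\ast G_\sigma$ minimizes $D_{\mathrm{KL}}(p_0\|p)=\int p_0\log(p_0/p)$ over $p\in\{\phi_\sigma\ast G:G\in\mathcal{P}(\Theta)\}$. NPMLE. $\widehat{G}_{n,\sigma}$ is any maximizer of $\sum_{i=1}^n\log(\phi_\sigma\ast G)(Y_i)$ over $G\in\mathcal{P}(\Theta)$, where $Y_1,\dots,Y_n$ are i.i.d. from $p_0$; it can be taken to be a discrete measure with at most $n$ atoms. Components. $\{S_{\sigma,k}\}_{k=1}^{N_\sigma}$ are the connected components of $\mathrm{supp}(G_\sigma)$ (the intersection of all closed sets of full $G_\sigma$-measure), $N_\sigma$ (finite) being their number. Set $\lambda_{\sigma,k}=G_\sigma(S_{\sigma,k})$ and $G_{\sigma,k}=G_\sigma(\cdot\,|\,S_{\sigma,k})$ (the conditional measure), so $G_\sigma=\sum_k\lambda_{\sigma,k}G_{\sigma,k}$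 and $p_\sigma=\sum_k\lambda_{\sigma,k}f_{\sigma,k}$ with $f_{\sigma,k}=\phi_\sigma\ast G_{\sigma,k}$. Estimators. Let $I_{\delta_n}=(2\delta_n)^{-d}\mathbf{1}_{[-\delta_n,\delta_n]^d}$ be the box kernel and $\widehat{g}_n=\widehat{G}_{n,\sigma}\ast I_{\delta_n}$. Apply single-linkage clustering to the (finitely many) connected pieces of the level set $\{x:\widehat{g}_n(x)>t_n\}$, with $\mathrm{dist}$ as distance between sets, until $N_\sigma$ clusters remain; the unions of the pieces in these clusters are denoted $\widehat{S}_{\sigma,1},\ldots,\widehat{S}_{\sigma,N_\sigma}$, with indices labelled so as to correspond to $S_{\sigma,1},\dots,S_{\sigma,N_\sigma}$ (i.e. the labels are understood up to a permutation). Define the Voronoi cells $E_k=\{x\in\Theta:\mathrm{dist}(x,\widehat{S}_{\sigma,k})\le\mathrm{dist}(x,\widehat{S}_{\sigma,j})\ \forall j\ne k\}$. Then $\widehat{\lambda}_{n,\sigma,k}=\widehat{G}_{n,\sigma}(E_k)$, $\widehat{G}_{n,\sigma,k}=\widehat{G}_{n,\sigma}(\cdot\,|\,E_k)$, and $\widehat{f}_{n,\sigma,k}=\phi_\sigma\ast\widehat{G}_{n,\sigma,k}$. *)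

(* Defs.v *)
From HB Require Import structures.
From mathcomp Require Import all_boot all_order all_algebra.
From mathcomp Require Import all_fingroup.
From mathcomp Require Import finmap.
From mathcomp Require Import all_classical all_reals all_analysis.
From mathcomp Require Import measurable_realfun.

Set Implicit Arguments.
Unset Strict Implicit.
Unset Printing Implicit Defensive.
Import Order.TTheory GRing.Theory Num.Theory.
Import numFieldNormedType.Exports.
Local Open Scope classical_set_scope.
Local Open Scope ring_scope.

(* R^d is 'rV[R]_d, with the topology of the library and the Borel
   sigma-algebra of that topology. *)
HB.instance Definition _ (R : realType) (d : nat) :=
  Measurable.copy 'rV[R]_d (g_sigma_algebraType (@open 'rV[R]_d)).

Section lebesgue_cons.
Context (R : realType) (d : nat).
Local Notation RT := (measurableTypeR R).
Variable mu : {sigma_finite_measure set (d.-tuple RT) -> \bar R}.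

Definition tuple_cons (p : RT * d.-tuple RT) : d.+1.-tuple RT :=
  [tuple of p.1 :: p.2].

Lemma measurable_tuple_cons : measurable_fun [set: RT * d.-tuple RT] tuple_cons.
Proof. exact: (measurable_cons measurable_fst measurable_snd). Qed.

Definition lebesgue_cons : set (d.+1.-tuple RT) -> \bar R :=
  pushforward (lebesgue_measure \x mu)%E tuple_cons.

Let mpre A : measurable A -> measurable (tuple_cons @^-1` A).
Proof.
by move=> mA; rewrite -[X in measurable X]setTI; exact: measurable_tuple_cons.
Qed.

Let lebesgue_cons0 : lebesgue_cons set0 = 0%E.
Proof. by rewrite /lebesgue_cons /pushforward preimage_set0 measure0. Qed.

Let lebesgue_cons_ge0 A : (0 <= lebesgue_cons A)%E.
Proof. by rewrite /lebesgue_cons /pushforward; exact: measure_ge0. Qed.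

Let lebesgue_cons_sigma_additive : semi_sigma_additive lebesgue_cons.
Proof.
move=> F mF tF mUF; rewrite /lebesgue_cons /pushforward preimage_bigcup.
apply: measure_semi_sigma_additive.
- by move=> n; exact: mpre.
- apply/trivIsetP => /= i j _ _ ij; rewrite -preimage_setI.
  by move/trivIsetP : tF => /(_ _ _ _ _ ij) ->//; rewrite preimage_set0.
- by rewrite -preimage_bigcup; exact: mpre.
Qed.

HB.instance Definition _ := isMeasure.Build _ _ _ lebesgue_cons
  lebesgue_cons0 lebesgue_cons_ge0 lebesgue_cons_sigma_additive.

Let lebesgue_cons_sigma_finite : sigma_finite setT lebesgue_cons.
Proof.
have /sigma_finiteP[F [TF ndF Foo]] := sigma_finiteT (@lebesgue_measure R).
have /sigma_finiteP[G [TG ndG Goo]] := sigma_finiteT mu.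
pose u (t : d.+1.-tuple RT) : RT * d.-tuple RT := (thead t, [tuple of behead t]).
have meas_u : measurable_fun setT u.
  by apply: measurable_fun_pair; [exact: measurable_tnth|exact: measurable_behead].
have uK : u \o tuple_cons = id.
  apply/funext => -[x t]; rewrite /u /tuple_cons/= theadE; congr pair.
  exact: val_inj.
exists (fun k => u @^-1` (F k `*` G k)).
  apply/esym; rewrite -subTset => t _.
  have [n _ Fn] : (\bigcup_i F i) (u t).1 by rewrite -TF.
  have [k _ Gk] : (\bigcup_i G i) (u t).2 by rewrite -TG.
  exists (maxn n k) => //; split.
    by move: Fn; exact/subsetPset/ndF/leq_maxl.
  by move: Gk; exact/subsetPset/ndG/leq_maxr.
move=> k; have [mF Fk] := Foo k; have [mG Gk] := Goo k; split.
  rewrite -[X in measurable X]setTI; apply: meas_u => //.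
  exact: measurableX.
rewrite /lebesgue_cons /pushforward -comp_preimage uK preimage_id.
by rewrite product_measure1E// lte_mul_pinfty// ge0_fin_numE.
Qed.

HB.instance Definition _ := Measure_isSigmaFinite.Build _ _ _ lebesgue_cons
  lebesgue_cons_sigma_finite.

End lebesgue_cons.

Section lebesgue_rV.
Context (R : realType).
Local Notation RT := (measurableTypeR R).

(* d-fold product of the one-dimensional Lebesgue measure *)
Fixpoint lebesgue_tuple (d : nat) :
    {sigma_finite_measure set (d.-tuple RT) -> \bar R} :=
  match d with
  | 0 => dirac [tuple]
  | d'.+1 => lebesgue_cons (lebesgue_tuple d')
  end.

Definition rV_of_tuple (d : nat) (t : d.-tuple RT) : 'rV[R]_d :=
  \row_i tnth t i.

Lemma open_rV_bigcup_ball (d : nat) (U : set 'rV[R]_d) : open U ->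
  U = \bigcup_(p in [set p : 'rV[rat]_d * nat |
         ball (map_mx ratr p.1 : 'rV[R]_d) p.2.+1%:R^-1 `<=` U])
        ball (map_mx ratr p.1 : 'rV[R]_d) p.2.+1%:R^-1.
Proof.
move=> oU; apply/seteqP; split=> [x Ux|x [p + xp]]; last exact.
have /nbhs_ballP[e /= e0 xeU] : nbhs x U by exact: open_nbhs_nbhs.
have [n ne] : exists n, n.+1%:R^-1 < e / 2.
  exists (Num.truncn (e / 2)^-1).
  by rewrite invf_plt ?posrE ?ltr0n ?divr_gt0// truncnS_gt.
have n0 : 0 < n.+1%:R^-1 :> R by rewrite invr_gt0 ltr0n.
have /choice[q qx] (i : 'I_d) : exists q : rat, ball (x 0 i) n.+1%:R^-1 (ratr q).
  have /rat_in_itvoo[q] : x 0 i - n.+1%:R^-1 < x 0 i + n.+1%:R^-1.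
    by rewrite ltrD2l (@lt_trans _ _ 0)// oppr_lt0.
  rewrite in_itv/= => qx; exists q.
  by rewrite -ball_normE/= distrC ltr_distl.
have xq : ball x n.+1%:R^-1 (map_mx ratr (\row_i q i) : 'rV[R]_d).
  by split=> // i j; rewrite !mxE ord1.
exists (\row_i q i, n) => /=; last exact: ball_sym.
apply: subset_trans xeU => y qy; rewrite [e]splitr.
exact: ball_triangle (le_ball (ltW ne) xq) (le_ball (ltW ne) qy).
Qed.

Lemma measurable_rV_of_tuple (d : nat) :
  measurable_fun [set: d.-tuple RT] (@rV_of_tuple d).
Proof.
apply: (@measurability _ _ _ _ _ _ (@open 'rV[R]_d)) => //.
move=> _ [U oU <-]; rewrite setTI (open_rV_bigcup_ball oU) preimage_bigcup.
rewrite bigcup_mkcond; apply: countable_bigcupT_measurable => // p.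
case: ifPn => // _.
rewrite (_ : _ @^-1` _ = \big[setI/setT]_(i < d)
    ((@tnth _ RT ^~ i) @^-1` ball (ratr (p.1 0 i) : R) p.2.+1%:R^-1)).
  apply: bigsetI_measurable => i _; rewrite -[X in measurable X]setTI.
  by apply: measurable_tnth => //; exact: measurable_ball.
apply/seteqP; split=> [t [_ pt]|t].
  by rewrite -bigcap_seq => i _ /=; move: (pt 0 i); rewrite !mxE.
rewrite -bigcap_seq => pt; split=> [|i j]; first by rewrite invr_gt0 ltr0n.
by rewrite !mxE ord1; apply: pt; rewrite /= mem_index_enum.
Qed.

Definition lebesgue_rV (d : nat) : set 'rV[R]_d -> \bar R :=
  pushforward (lebesgue_tuple d) (@rV_of_tuple d).


Let lebesgue_rV0 d : @lebesgue_rV d set0 = 0%E.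
Proof. by rewrite /lebesgue_rV /pushforward preimage_set0 measure0. Qed.

Let lebesgue_rV_ge0 d A : (0 <= @lebesgue_rV d A)%E.
Proof. by rewrite /lebesgue_rV /pushforward; exact: measure_ge0. Qed.

Let lebesgue_rV_sigma_additive d : semi_sigma_additive (@lebesgue_rV d).
Proof.
move=> F mF tF mUF; rewrite /lebesgue_rV /pushforward preimage_bigcup.
have mpre A : measurable A -> measurable (@rV_of_tuple d @^-1` A).
  move=> mA; rewrite -[X in measurable X]setTI.
  exact: measurable_rV_of_tuple.
apply: measure_semi_sigma_additive.
- by move=> n; exact: mpre.
- apply/trivIsetP => /= i j _ _ ij; rewrite -preimage_setI.
  by move/trivIsetP : tF => /(_ _ _ _ _ ij) ->//; rewrite preimage_set0.
- by rewrite -preimage_bigcup; exact: mpre.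
Qed.

HB.instance Definition _ d := isMeasure.Build _ _ _ (@lebesgue_rV d)
  (lebesgue_rV0 d) (@lebesgue_rV_ge0 d) (@lebesgue_rV_sigma_additive d).

End lebesgue_rV.

Section mixtures.
Context (R : realType) (d : nat).
Local Notation Rd := 'rV[R]_d.
Implicit Types (G : set Rd -> \bar R) (Theta A B E L : set Rd).

(* Euclidean norm (the norm `|x| of the library on matrices is the sup norm) *)
Definition enorm (x : Rd) : R := Num.sqrt (\sum_i x 0 i ^+ 2).

Definition gauss (sigma : R) (x : Rd) : R :=
  Num.sqrt (2 * pi * sigma ^+ 2) ^- d *
  expR (- (enorm x ^+ 2 / (2 * sigma ^+ 2))).

Definition box (delta : R) (x : Rd) : R :=
  (2 * delta) ^- d * \1_[set y : Rd | forall i, `|y 0 i| <= delta] x.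

(* The density of K * G. Here G is a bare set function, so that the definition
   also applies to the conditional measure mcond below. *)
Definition convm (K : Rd -> R) G (x : Rd) : R :=
  fine (\int[G]_theta (K (x - theta))%:E)%E.

(* the conditional measure G(. | E) *)
Definition mcond G E : set Rd -> \bar R :=
  fun A => (G (A `&` E) * (fine (G E))^-1%:E)%E.

Definition probs_on Theta : set (probability Rd R) :=
  [set G | G Theta = 1%E].

Definition supp G : set Rd :=
  \bigcap_(C in [set C : set Rd | closed C /\ G C = 1%E]) C.

Definition components A : set (set Rd) :=
  [set connected_component A x | x in A].

Definition is_density (p : Rd -> R) : Prop :=
  [/\ measurable_fun setT p, forall x, 0 <= p x &
      (\int[@lebesgue_rV R d]_x (p x)%:E = 1)%E].

(* Since ln 0 = 0 in the library, the integrand vanishes where p does. *)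
Definition kl (p q : Rd -> R) : \bar R :=
  (\int[@lebesgue_rV R d]_x (p x * ln (p x / q x))%:E)%E.

Definition l1dist (f g : Rd -> R) : \bar R :=
  (\int[@lebesgue_rV R d]_x (`|f x - g x|%R)%:E)%E.

Definition minimizes_kl Theta (sigma : R) (p0 : Rd -> R)
    (G : probability Rd R) : Prop :=
  probs_on Theta G /\
  forall G' : probability Rd R, probs_on Theta G' ->
    (kl p0 (convm (gauss sigma) G) <= kl p0 (convm (gauss sigma) G'))%E.

Definition is_projection Theta (sigma : R) (p0 : Rd -> R)
    (G : probability Rd R) : Prop :=
  minimizes_kl Theta sigma p0 G /\
  forall G' : probability Rd R, minimizes_kl Theta sigma p0 G' ->
    forall A, measurable A -> G' A = G A.

Definition is_npmle Theta (sigma : R) (n : nat) (y : 'I_n -> Rd)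
    (G : probability Rd R) : Prop :=
  probs_on Theta G /\
  forall G' : probability Rd R, probs_on Theta G' ->
    \sum_(i < n) ln (convm (gauss sigma) G' (y i)) <=
    \sum_(i < n) ln (convm (gauss sigma) G (y i)).

Definition couplings G G' : set (probability (Rd * Rd)%type R) :=
  [set gam | forall A, measurable A ->
    gam (A `*` setT) = G A /\ gam (setT `*` A) = G' A].

Definition wasserstein1 G G' : \bar R :=
  ereal_inf [set (\int[gam]_z (enorm (z.1 - z.2))%:E)%E
            | gam in couplings G G'].

(* with value +oo if A or B is empty *)
Definition setdist A B : \bar R :=
  ereal_inf [set (enorm (z.1 - z.2))%:E | z in A `*` B].

(* One agglomeration step. A cluster of pieces is represented by the union of
   its pieces: the single-linkage distance between two clusters, i.e. the least
   distance between a piece of one and a piece of the other, is the distance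
   between these unions. Ties are broken arbitrarily. *)
Definition merge_step (C C' : set (set Rd)) : Prop :=
  exists A B, [/\ C A, C B, A <> B,
    forall A' B', C A' -> C B' -> A' <> B' ->
      (setdist A B <= setdist A' B')%E &
    C' = (C `\` [set A; B]) `|` [set A `|` B]].

Inductive merges (C : set (set Rd)) : set (set Rd) -> Prop :=
| merges_refl : merges C C
| merges_step C1 C2 : merges C C1 -> merge_step C1 C2 -> merges C C2.

(* S enumerates, in an arbitrary order, the N clusters that remain when
   single-linkage clustering of the connected pieces of L is stopped. *)
Definition single_linkage (N : nat) L (S : 'I_N -> set Rd) : Prop :=
  exists2 C, merges (components L) C & set_bij [set: 'I_N] C S.

Definition voronoi Theta (N : nat) (S : 'I_N -> set Rd) (k : 'I_N) : set Rd :=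
  [set x | Theta x /\ forall j, j != k ->
    (setdist [set x] (S k) <= setdist [set x] (S j))%E].

Definition level_set (delta t : R) G : set Rd :=
  [set x | t < convm (box delta) G x].

End mixtures.

Section sampling.
Context (R : realType) (d : nat) (dO : measure_display).
Context (Omega : measurableType dO) (P : probability Omega R).

Definition independent_RVs (Y : nat -> {RV P >-> 'rV[R]_d}) : Prop :=
  forall (J : {fset nat}) (A : nat -> set 'rV[R]_d),
    (forall i, measurable (A i)) ->
    P (\bigcap_(i in [set` J]) (Y i @^-1` A i)) =
    (\prod_(i <- J) P (Y i @^-1` A i))%E.

Definition iid_sample (p0 : 'rV[R]_d -> R)
    (Y : nat -> {RV P >-> 'rV[R]_d}) : Prop :=
  independent_RVs Y /\
  forall i A, measurable A ->
    distribution P (Y i) A = (\int[@lebesgue_rV R d]_(x in A) (p0 x)%:E)%E.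

End sampling.

(* Main.v *)
(* The hypothesis on t_n reads
     W_1(Gh_n, G_sigma) <= 2^d sqrt(d) delta_n^(d+1) t_n,
   so t_n -> 0 and delta_n -> 0 force W_1 -> 0 without any appeal to the
   consistency of the NPMLE: the statement is deterministic along each sample
   path.  A point of the level set farther than 2 sqrt(d) delta_n from
   supp G_sigma would cost more to transport than this bound allows, so the
   level set shrinks to supp G_sigma; a pigeonhole over boxes of half-side delta_n shows that it
   comes eps-close to every point of supp G_sigma.  Since each component S_k is
   connected and the components are rho apart with rho >= 8 eps, single linkage
   with more than N clusters always merges two clusters around the same S_k, so
   the N final clusters are the traces of the level set near the S_k.  Hence, up
   to a permutation, the Voronoi cell of S_k agrees with S_k along any
   transported pair at distance < eps, and integrating against an almost optimal
   coupling bounds the errors on the weights and (by a Gaussian envelope) on the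
   densities by a constant times t_n. *)

Require Import Defs.
From HB Require Import structures.
From mathcomp Require Import all_boot all_order all_algebra.
From mathcomp Require Import all_fingroup.
From mathcomp Require Import finmap.
From mathcomp Require Import all_classical all_reals all_analysis.
From mathcomp Require Import measurable_realfun.
From mathcomp Require Import ring lra.

Set Implicit Arguments.
Unset Strict Implicit.
Unset Printing Implicit Defensive.
Import Order.TTheory GRing.Theory Num.Theory.
Import numFieldNormedType.Exports.
Local Open Scope classical_set_scope.
Local Open Scope ring_scope.

(** * Euclidean norm *)

Section enorm_theory.
Context (R : realType) (d : nat).
Local Notation Rd := 'rV[R]_d.
Implicit Types (x y z : Rd) (A B U : set Rd).

Lemma enorm_ge0 x : 0 <= enorm x.
Proof. exact: sqrtr_ge0. Qed.

Lemma enorm0 : enorm (0 : Rd) = 0.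
Proof. by rewrite /enorm big1 ?sqrtr0// => i _; rewrite mxE expr0n. Qed.

Lemma enorm_sqr x : enorm x ^+ 2 = \sum_i x 0 i ^+ 2.
Proof. by rewrite sqr_sqrtr// sumr_ge0// => i _; exact: sqr_ge0. Qed.

Lemma enormN x : enorm (- x) = enorm x.
Proof. by congr Num.sqrt; apply: eq_bigr => i _; rewrite mxE sqrrN. Qed.

Lemma enormB x y : enorm (x - y) = enorm (y - x).
Proof. by rewrite -enormN opprB. Qed.

(** By Lagrange's identity: twice the gap between the squares of the two sides is the double sum of
    the squares of [x_i y_j - x_j y_i]. Squaring is legitimate once a nonpositive inner product is
    set aside. *)
Lemma cauchy_schwarz_rV x y : \sum_i x 0 i * y 0 i <= enorm x * enorm y.
Proof.
have [|s0] := leP (\sum_i x 0 i * y 0 i) 0.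
  by move=> /le_trans; apply; rewrite mulr_ge0 ?enorm_ge0.
rewrite -(@ler_pXn2r _ 2)// ?nnegrE ?mulr_ge0 ?enorm_ge0 ?(ltW s0)//.
rewrite exprMn !enorm_sqr -subr_ge0 -(@pmulr_rge0 _ 2)//.
have -> : 2 * ((\sum_i x 0 i ^+ 2) * (\sum_i y 0 i ^+ 2) -
    (\sum_i x 0 i * y 0 i) ^+ 2) =
    \sum_i \sum_j (x 0 i * y 0 j - x 0 j * y 0 i) ^+ 2.
  transitivity (\sum_i \sum_j (x 0 i ^+ 2 * y 0 j ^+ 2 + y 0 i ^+ 2 * x 0 j ^+ 2
      - 2 * ((x 0 i * y 0 i) * (x 0 j * y 0 j)))); last first.
    by apply: eq_bigr => i _; apply: eq_bigr => j _; ring.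
  under [RHS]eq_bigr do rewrite sumrB big_split/= -!mulr_sumr.
  by rewrite sumrB big_split/= -mulr_sumr -!mulr_suml; ring.
by rewrite sumr_ge0// => i _; rewrite sumr_ge0// => j _; exact: sqr_ge0.
Qed.

Lemma enormD x y : enorm (x + y) <= enorm x + enorm y.
Proof.
rewrite -(@ler_pXn2r _ 2)// ?nnegrE ?addr_ge0 ?enorm_ge0//.
rewrite sqrrD !enorm_sqr.
have -> : \sum_i (x + y) 0 i ^+ 2 = \sum_i x 0 i ^+ 2 +
    (\sum_i x 0 i * y 0 i) *+ 2 + \sum_i y 0 i ^+ 2.
  rewrite -sumrMnl -!big_split/=; apply: eq_bigr => i _.
  by rewrite mxE sqrrD.
by rewrite lerD2r lerD2l lerMn2r cauchy_schwarz_rV.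
Qed.

Lemma enorm_triangle y x z : enorm (x - z) <= enorm (x - y) + enorm (y - z).
Proof. by rewrite (le_trans _ (enormD _ _))// addrA subrK. Qed.

Lemma coord_le_enorm x i : `|x 0 i| <= enorm x.
Proof.
rewrite -sqrtr_sqr ler_wsqrtr// (bigD1 i)//= lerDl.
by rewrite sumr_ge0// => j _; exact: sqr_ge0.
Qed.

Lemma enorm_le_coord x (r : R) : 0 <= r -> (forall i, `|x 0 i| <= r) ->
  enorm x <= Num.sqrt d%:R * r.
Proof.
move=> r0 xr; rewrite -[r in leRHS]ger0_norm// -[X in _ * X]sqrtr_sqr.
rewrite -sqrtrM ?ler0n// ler_wsqrtr//.
rewrite (@le_trans _ _ (\sum_(i < d) r ^+ 2))//.
  apply: ler_sum => i _; rewrite -[leLHS]real_normK ?num_real//.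
  by rewrite ler_pXn2r ?nnegrE.
by rewrite sumr_const card_ord mulr_natl.
Qed.

Lemma ball_enorm x y (r : R) : enorm (x - y) < r -> ball x r y.
Proof.
move=> xyr; split; first exact: le_lt_trans (enorm_ge0 _) xyr.
move=> i j; rewrite ord1 -ball_normE/=; apply: le_lt_trans xyr.
by rewrite (le_trans _ (coord_le_enorm _ j))// !mxE.
Qed.

Lemma enorm_ball x y (r : R) : ball x r y ->
  enorm (x - y) <= Num.sqrt d%:R * r.
Proof.
move=> [r0 xyr]; apply: enorm_le_coord; first exact: ltW.
by move=> i; move: (xyr 0 i); rewrite -ball_normE/= !mxE => /ltW.
Qed.

Lemma open_enormP U : open U <->
  forall x, U x -> exists2 r, 0 < r & forall y, enorm (x - y) < r -> U y.
Proof.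
split=> [oU x Ux|rU].
  have /nbhs_ballP[r /= r0 rU] : nbhs x U by exact: open_nbhs_nbhs.
  by exists r => // y xy; apply: rU; exact: ball_enorm.
rewrite openE => x /rU[r r0 {}rU]; apply/nbhs_ballP.
(* The sup-norm ball of radius r' lies within Euclidean distance [sqrt d] r' of its centre; adding 1
   to the denominator makes the inclusion strict and keeps the radius meaningful for d = 0. *)
have s0 : 0 < Num.sqrt d%:R + 1 :> R by rewrite ltr_wpDl ?sqrtr_ge0.
exists (r / (Num.sqrt d%:R + 1)); first by rewrite /= divr_gt0.
move=> y /enorm_ball xy; apply: rU; apply: le_lt_trans xy _.
by rewrite mulrCA gtr_pMr// ltr_pdivrMr// mul1r ltrDl.
Qed.

Lemma enorm_dist_le x y z : `|enorm (x - z) - enorm (y - z)| <= enorm (x - y).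
Proof.
rewrite ler_norml; have := enorm_triangle y x z; have := enorm_triangle x y z.
by rewrite (enormB y x) => ? ?; apply/andP; split; lra.
Qed.

Definition nbd A (r : R) : set Rd :=
  [set x | exists2 a, A a & enorm (x - a) < r].

Lemma open_nbd A r : open (nbd A r).
Proof.
apply/open_enormP => x [a Aa xa]; exists (r - enorm (x - a)).
  by rewrite subr_gt0.
move=> y xy; exists a => //; have := enorm_triangle x y a.
by rewrite (enormB y x) => ?; lra.
Qed.

(** The Euclidean ball, as opposed to [ball], which is the sup-norm one on row vectors. *)
Definition eball x (r : R) : set Rd := [set y | enorm (y - x) < r].

Lemma open_eball x r : open (eball x r).
Proof.
have -> : eball x r = nbd [set x] r.
  by apply/seteqP; split => [y yx|y [_ -> //]]; exists x.
exact: open_nbd.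
Qed.

Lemma open_measurable_rV U : open U -> measurable U.
Proof. by move=> oU; apply: sub_sigma_algebra. Qed.

Lemma closed_measurable_rV U : closed U -> measurable U.
Proof.
move=> cU; rewrite -[U]setCK; apply: measurableC; apply: open_measurable_rV.
exact: closed_openC.
Qed.

Lemma continuous_measurable_rV (f : Rd -> R) :
  continuous f -> measurable_fun setT f.
Proof.
move=> cf; apply: (measurability (@RGenOpens.G R)).
  exact: RGenOpens.measurableE.
move=> _ [_ [a [b ->] <-]]; rewrite setTI; apply: open_measurable_rV.
by apply: open_comp => [x _|]; [exact: cf|exact: itv_open_ends_open].
Qed.

Lemma measurable_coord i : measurable_fun setT (fun x : Rd => x 0 i).
Proof. by apply: continuous_measurable_rV; exact: coord_continuous. Qed.

(** Measurability is meant for the product of the two Borel sigma-algebras, so it is built up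
    coordinate by coordinate. *)
Lemma measurable_enormB :
  measurable_fun setT (fun z : Rd * Rd => enorm (z.1 - z.2)).
Proof.
apply: (@measurableT_comp _ _ _ _ _ _ (@Num.sqrt R)).
  by apply: continuous_measurable_fun; exact: sqrt_continuous.
apply: measurable_sum => i; apply: measurable_funX.
under eq_fun do rewrite !mxE.
by apply: measurable_funB; apply: (measurableT_comp (measurable_coord i)).
Qed.

End enorm_theory.

(** * Couplings *)

Section coupling.
Context (R : realType) (d : nat).
Local Notation Rd := 'rV[R]_d.
Variables (G G' : probability Rd R) (gam : probability (Rd * Rd)%type R).
Hypothesis gamP : couplings G G' gam.

(** The projections are packed as measurable functions so that the pushforwards of [gam] along them
    are recognized as measures and can be compared with the marginals. *)
Let fst_mfun := isMeasurableFun.Build _ _ _ _ _ (@measurable_fst _ _ Rd Rd).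
Let fst_pack : {mfun _ >-> _} := HB.pack (@fst Rd Rd) fst_mfun.
Let snd_mfun := isMeasurableFun.Build _ _ _ _ _ (@measurable_snd _ _ Rd Rd).
Let snd_pack : {mfun _ >-> _} := HB.pack (@snd Rd Rd) snd_mfun.

Lemma ge0_integral_coupling_fst (f : Rd -> \bar R) :
  measurable_fun setT f -> (forall x, (0 <= f x)%E) ->
  (\int[G]_x f x = \int[gam]_z f z.1)%E.
Proof.
move=> mf f0; transitivity (\int[pushforward gam fst]_x f x)%E; last first.
  by rewrite ge0_integral_pushforward//; exact: measurable_fst.
apply: (eq_measure_integral (pushforward gam fst_pack)) => A mA _.
have [GA _] := gamP mA; apply: etrans (esym GA) _; rewrite /= /pushforward; congr (gam _).
by apply/seteqP; split => // z [].
Qed.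

Lemma ge0_integral_coupling_snd (f : Rd -> \bar R) :
  measurable_fun setT f -> (forall x, (0 <= f x)%E) ->
  (\int[G']_x f x = \int[gam]_z f z.2)%E.
Proof.
move=> mf f0; transitivity (\int[pushforward gam snd]_x f x)%E; last first.
  by rewrite ge0_integral_pushforward//; exact: measurable_snd.
apply: (eq_measure_integral (pushforward gam snd_pack)) => A mA _.
have [_ GA] := gamP mA; apply: etrans (esym GA) _; rewrite /= /pushforward; congr (gam _).
by apply/seteqP; split => // z [].
Qed.

Lemma coupling_ae (A B : set Rd) : measurable A -> measurable B ->
  G A = 1%E -> G' B = 1%E -> {ae gam, forall z, A z.1 /\ B z.2}.
Proof.
move=> mA mB GA G'B.
exists ((~` A `*` setT) `|` (setT `*` ~` B)); split.
- by apply: measurableU; apply: measurableX => //; exact: measurableC.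
- apply/eqP; rewrite -measure_le0.
  apply: (le_trans (measureU2 _ _ _)).
  + by apply: measurableX => //; exact: measurableC.
  + by apply: measurableX => //; exact: measurableC.
  have e1 : gam (~` A `*` setT) = 0%E.
    by have [-> _] := gamP (measurableC mA); rewrite probability_setC// GA subee.
  have e2 : gam (setT `*` ~` B) = 0%E.
    by have [_ ->] := gamP (measurableC mB); rewrite probability_setC// G'B subee.
  by rewrite [X in (X + _)%E]e1 [X in (_ + X)%E]e2 adde0.
- move=> z /= /not_andP[nA|nB]; [by left|by right].
Qed.

Local Notation cost := (\int[gam]_z (enorm (z.1 - z.2))%:E)%E.

(** A pointwise inequality on the product of [A] and [B] can be integrated because every coupling
    gives that product full mass. All later comparisons of the two marginals go through this
    inequality. *)
Lemma coupling_le_cost (A B : set Rd) (f g : Rd * Rd -> R) (c : R) :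
  measurable A -> measurable B -> G A = 1%E -> G' B = 1%E ->
  measurable_fun setT f -> measurable_fun setT g ->
  (forall z, 0 <= f z) -> (forall z, 0 <= g z) -> 0 <= c ->
  (forall z, A z.1 -> B z.2 -> f z <= g z + c * enorm (z.1 - z.2)) ->
  (\int[gam]_z (f z)%:E <= \int[gam]_z (g z)%:E + c%:E * cost)%E.
Proof.
move=> mA mB GA G'B mf mg f0 g0 c0 fg.
have mcost : measurable_fun setT (fun z : Rd * Rd => (enorm (z.1 - z.2))%:E).
  by apply/measurable_EFinP; exact: measurable_enormB.
rewrite -ge0_integralZl//; last by move=> z _; rewrite lee_fin enorm_ge0.
rewrite -ge0_integralD//.
- apply: ae_ge0_le_integral => //.
  + by move=> z _; rewrite lee_fin.
  + exact/measurable_EFinP.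
  + by move=> z _; rewrite -EFinM -EFinD lee_fin addr_ge0 ?mulr_ge0 ?enorm_ge0.
  + by apply: emeasurable_funD; [exact/measurable_EFinP|exact: emeasurable_funM].
  + apply: filterS (coupling_ae mA mB GA G'B) => z [Az Bz] _.
    by rewrite -EFinM -EFinD lee_fin; exact: fg.
- by move=> z _; rewrite lee_fin.
- exact/measurable_EFinP.
- by move=> z _; rewrite -EFinM lee_fin mulr_ge0 ?enorm_ge0.
- exact: emeasurable_funM.
Qed.

Section transport.
Variables (A B : set Rd) (f g : Rd -> R) (c : R).
Hypotheses (mA : measurable A) (mB : measurable B).
Hypotheses (GA : G A = 1%E) (G'B : G' B = 1%E).
Hypotheses (mf : measurable_fun setT f) (mg : measurable_fun setT g).
Hypotheses (f0 : forall x, 0 <= f x) (g0 : forall x, 0 <= g x) (c0 : 0 <= c).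

Let mf1 : measurable_fun setT (fun z : Rd * Rd => f z.1).
Proof. exact: (measurableT_comp mf). Qed.
Let mg2 : measurable_fun setT (fun z : Rd * Rd => g z.2).
Proof. exact: (measurableT_comp mg). Qed.

(** The easy half of Kantorovich duality, for a pair of test functions related only on sets of full
    measure. *)
Lemma coupling_le_fst :
  (forall x y, A x -> B y -> f x <= g y + c * enorm (x - y)) ->
  (\int[G]_x (f x)%:E <= \int[G']_x (g x)%:E + c%:E * cost)%E.
Proof.
move=> fg; rewrite ge0_integral_coupling_fst//; [|exact/measurable_EFinP].
rewrite ge0_integral_coupling_snd//; [|exact/measurable_EFinP].
by apply: (coupling_le_cost mA mB) => // z; exact: fg.
Qed.

Lemma coupling_le_snd :
  (forall x y, A x -> B y -> g y <= f x + c * enorm (x - y)) ->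
  (\int[G']_x (g x)%:E <= \int[G]_x (f x)%:E + c%:E * cost)%E.
Proof.
move=> fg; rewrite ge0_integral_coupling_fst//; [|exact/measurable_EFinP].
rewrite ge0_integral_coupling_snd//; [|exact/measurable_EFinP].
by apply: (coupling_le_cost mA mB) => // z; exact: fg.
Qed.

End transport.

End coupling.

(** * Integration against conditional measures *)

Section mcond_integral.
Context (R : realType) (d : nat).
Local Notation Rd := 'rV[R]_d.
Variables (G : probability Rd R) (E : set Rd).
Hypothesis mE : measurable E.

Lemma ge0_integral_mrestr (f : Rd -> \bar R) :
  measurable_fun setT f -> (forall x, (0 <= f x)%E) ->
  (\int[mrestr G mE]_x f x = \int[G]_(x in E) f x)%E.
Proof.
move=> mf f0; rewrite -(setUv E) ge0_integral_setU//.
- rewrite [X in (_ + X)%E](_ : _ = 0%E) ?adde0.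
    apply: eq_measure_integral => A mA AE.
    by rewrite /= /mrestr setIidl.
  apply: null_set_integral => //; first exact: measurableC.
  + exact: measurable_funTS.
  + by rewrite /= /mrestr setICl measure0.
- exact: measurableC.
- by rewrite setUv.
- by apply/disj_setPCl.
Qed.

(** [mcond] is a bare set function; it is identified with a rescaled restriction of [G], to which
    the rules for integrals against measures apply. A null cell is covered by the convention that
    the inverse of 0 is 0. *)
Lemma ge0_integral_mcond (f : Rd -> \bar R) :
  measurable_fun setT f -> (forall x, (0 <= f x)%E) ->
  (\int[mcond G E]_x f x = (fine (G E))^-1%:E * \int[G]_(x in E) f x)%E.
Proof.
move=> mf f0.
have k0 : 0 <= (fine (G E))^-1 by rewrite invr_ge0 fine_ge0.
have -> : mcond G E = mscale (NngNum k0) (mrestr G mE).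
  by apply/funext => A; rewrite /mcond /mscale/= /mrestr muleC.
by rewrite ge0_integral_mscale// ge0_integral_mrestr.
Qed.

End mcond_integral.

(** * Gaussian envelopes *)

Section gaussian_envelope.
Context (R : realType).
Local Notation RT := (measurableTypeR R).

Lemma integral_expRN_sqr_lty (c : R) : 0 < c ->
  (\int[@lebesgue_measure R]_x (expR (- (c * x ^+ 2)))%:E < +oo)%E.
Proof.
(* The standard deviation of the centred normal law whose density is proportional to exp(- c
   x^2). *)
move=> c0; pose s := Num.sqrt (2 * c)^-1.
have s0 : 0 < s by rewrite sqrtr_gt0 invr_gt0 mulr_gt0.
have s2 : s ^+ 2 *+ 2 = c^-1.
  by rewrite sqr_sqrtr ?invr_ge0 ?mulr_ge0 ?(ltW c0)// -mulr_natr; field; lra.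
have p0 : 0 < normal_peak s by rewrite normal_peak_gt0// gt_eqF.
have -> : (\int[@lebesgue_measure R]_x (expR (- (c * x ^+ 2)))%:E =
    \int[@lebesgue_measure R]_x
      ((normal_peak s)^-1%:E * (normal_pdf 0 s x)%:E))%E.
  apply: eq_integral => x _; rewrite -EFinM /normal_pdf gt_eqF//.
  by rewrite mulKf ?gt_eqF// /normal_fun subr0 s2 invrK mulNr mulrC.
rewrite ge0_integralZl//.
- by rewrite integral_normal_pdf mule1 ltry.
- by apply/measurable_EFinP; exact: measurable_normal_pdf.
- by move=> x _; rewrite lee_fin normal_pdf_ge0.
- by rewrite lee_fin invr_ge0 ltW.
Qed.

Lemma measurable_expRN_sqr_tuple (c : R) (d : nat) :
  measurable_fun setT (fun t : d.-tuple RT =>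
    expR (- (c * \sum_i tnth t i ^+ 2))).
Proof.
apply: measurableT_comp => //; apply: measurableT_comp => //.
apply: measurable_funM => //; apply: measurable_sum => i.
by apply: measurable_funX; exact: measurable_tnth.
Qed.

(** Induction on the dimension by Tonelli: the exponential of the sum splits into a factor in the
    head and a factor in the tail. In dimension 0 the measure is a Dirac mass. *)
Lemma integral_tuple_expRN_sqr_lty (c : R) (d : nat) : 0 < c ->
  (\int[lebesgue_tuple R d]_t
     (expR (- (c * \sum_i tnth t i ^+ 2)))%:E < +oo)%E.
Proof.
move=> c0; elim: d => [|d IH].
  rewrite /= integral_dirac//; last first.
    by apply/measurable_EFinP; exact: measurable_expRN_sqr_tuple.
  by rewrite diracT mul1e ltry.
have mF : measurable_fun setT (fun z : RT * d.-tuple RT =>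
    (expR (- (c * z.1 ^+ 2)) * expR (- (c * \sum_i tnth z.2 i ^+ 2)))%:E).
  apply/measurable_EFinP; apply: measurable_funM.
    apply: measurableT_comp => //; apply: measurableT_comp => //.
    by apply: measurable_funM => //; exact: measurable_funX.
  apply: measurableT_comp => //; apply: measurableT_comp => //.
  apply: measurable_funM => //; apply: measurable_sum => i.
  apply: measurable_funX.
  exact: (measurableT_comp (measurable_tnth i) measurable_snd).
rewrite /= /lebesgue_cons ge0_integral_pushforward//; last 2 first.
- exact: measurable_tuple_cons.
- by apply/measurable_EFinP; exact: measurable_expRN_sqr_tuple.
rewrite preimage_setT (eq_integral (fun z : RT * d.-tuple RT =>
    (expR (- (c * z.1 ^+ 2)) * expR (- (c * \sum_i tnth z.2 i ^+ 2)))%:E)%E);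
  last first.
  move=> z _ /=; congr EFin; rewrite -expRD; congr expR.
  rewrite big_ord_recl/= -opprD -mulrDr; congr (- (c * (_ + _))).
  by apply: eq_bigr => i _; rewrite tnthS.
rewrite fubini_tonelli1//.
rewrite /fubini_F.
set I := (X in (X < +oo)%E) in IH.
rewrite (eq_integral (fun x : RT => I * (expR (- (c * x ^+ 2)))%:E)%E); last first.
  move=> x _ /=; under eq_integral do rewrite EFinM.
  rewrite ge0_integralZl//; first exact: muleC.
  by apply/measurable_EFinP; exact: measurable_expRN_sqr_tuple.
have I0 : (0 <= I)%E by apply: integral_ge0 => t _; rewrite lee_fin expR_ge0.
rewrite ge0_integralZl//.
- apply: lte_mul_pinfty => //; first by rewrite ge0_fin_numE.
  exact: integral_expRN_sqr_lty.
- apply/measurable_EFinP; apply: measurableT_comp => //.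
  by apply: measurableT_comp => //; exact: measurable_funM.
Qed.

Context (d : nat).
Local Notation Rd := 'rV[R]_d.

Lemma measurable_expRN_enorm (c : R) :
  measurable_fun setT (fun x : Rd => expR (- (c * enorm x ^+ 2))).
Proof.
apply: measurableT_comp => //; apply: measurableT_comp => //.
apply: measurable_funM => //; under eq_fun do rewrite enorm_sqr.
apply: measurable_sum => i.
by apply: measurable_funX; exact: measurable_coord.
Qed.

Lemma integral_expRN_enorm_lty (c : R) : 0 < c ->
  (\int[@lebesgue_rV R d]_x (expR (- (c * enorm x ^+ 2)))%:E < +oo)%E.
Proof.
move=> c0; rewrite /lebesgue_rV ge0_integral_pushforward//.
- rewrite preimage_setT; under eq_integral => t _.
    rewrite /= enorm_sqr; under eq_bigr do rewrite mxE; over.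
  exact: integral_tuple_expRN_sqr_lty.
- exact: measurable_rV_of_tuple.
- by apply/measurable_EFinP; exact: measurable_expRN_enorm.
Qed.

(** For a <= b, e^-a - e^-b = e^-a (1 - e^-(b - a)), where the first factor is at most [B] and the
    second at most b - a. *)
Lemma expRN_lip (a b B : R) : expR (- a) <= B -> expR (- b) <= B ->
  `|expR (- a) - expR (- b)| <= `|a - b| * B.
Proof.
wlog ab : a b / a <= b.
  move=> H; have [/H//|/ltW/H {}H] := leP a b.
  by move=> ? ?; rewrite distrC (distrC a); exact: H.
move=> aB _; rewrite ger0_norm ?subr_ge0 ?ler_expR ?lerN2//.
rewrite distrC ger0_norm ?subr_ge0//.
have -> : expR (- b) = expR (- a) * expR (- (b - a)).
  by rewrite -expRD; congr expR; ring.
rewrite -{1}(mulr1 (expR (- a))) -mulrBr (mulrC (b - a)).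
have h1 : 1 - expR (- (b - a)) <= b - a.
  by have := expR_ge1Dx (- (b - a)); lra.
apply: ler_pM => //.
by rewrite subr_ge0 expR_le1 oppr_le0 subr_ge0.
Qed.

(** From |x|^2 <= 2 |x - th|^2 + 2 |th|^2, each translate is at most a constant times exp(- |x|^2 /
    (2 s2)), which gives [B]. The envelope [q] keeps only half of this decay; the other half absorbs
    the Lipschitz constant of the squared norm, which grows linearly in |x|. The same integrable [q]
    thus controls both size and variation in th. *)
Lemma gauss_envelope (sigma M : R) : 0 < sigma -> 0 <= M ->
  exists q : Rd -> R, exists2 L : R, 0 <= L &
  [/\ (forall x, 0 <= q x), measurable_fun setT q,
    (\int[@lebesgue_rV R d]_x (q x)%:E < +oo)%E,
    (forall x th : Rd, enorm th <= M -> gauss sigma (x - th) <= q x) &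
    (forall x th th' : Rd, enorm th <= M -> enorm th' <= M ->
      `|gauss sigma (x - th) - gauss sigma (x - th')|
        <= L * q x * enorm (th - th'))].
Proof.
move=> sigma0 M0; set K := Num.sqrt (2 * pi * sigma ^+ 2) ^- d.
have K0 : 0 <= K by rewrite invr_ge0 exprn_ge0 ?sqrtr_ge0.
set s2 := 2 * sigma ^+ 2.
have s20 : 0 < s2 by rewrite mulr_gt0 ?exprn_gt0.
pose B (x : Rd) := expR (M ^+ 2 / s2) * expR (- ((2 * s2)^-1 * enorm x ^+ 2)).
pose q (x : Rd) :=
  (K * expR (M ^+ 2 / s2)) * expR (- ((4 * s2)^-1 * enorm x ^+ 2)).
have KE0 : 0 <= K * expR (M ^+ 2 / s2) by rewrite mulr_ge0 ?expR_ge0.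
have gB (x th : Rd) : enorm th <= M -> expR (- (enorm (x - th) ^+ 2 / s2)) <= B x.
  move=> thM; rewrite /B -expRD ler_expR.
  have -> : M ^+ 2 / s2 + - ((2 * s2)^-1 * enorm x ^+ 2) =
      (M ^+ 2 - enorm x ^+ 2 / 2) / s2 by field; lra.
  rewrite -mulNr ler_pM2r ?invr_gt0//.
  have xth : enorm x <= enorm (x - th) + enorm th.
    by rewrite -{1}(subrK th x) enormD.
  have th0 := enorm_ge0 th; have x0 := enorm_ge0 x.
  have xth0 := enorm_ge0 (x - th).
  have : enorm x ^+ 2 <= (enorm (x - th) + enorm th) ^+ 2.
    by rewrite ler_pXn2r ?nnegrE ?addr_ge0.
  have : enorm th ^+ 2 <= M ^+ 2 by rewrite ler_pXn2r ?nnegrE.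
  have := sqr_ge0 (enorm (x - th) - enorm th).
  by rewrite !expr2; nra.
have BK (x : Rd) : K * B x =
    q x * expR (- ((4 * s2)^-1 * enorm x ^+ 2)).
  rewrite /q /B mulrA -[RHS]mulrA -expRD; congr (_ * expR _).
  by field; lra.
exists q; exists ((1 + 2 * M + 4 * s2) / s2).
  by rewrite divr_ge0 ?(ltW s20)//; lra.
have q0 x : 0 <= q x by rewrite mulr_ge0 ?expR_ge0.
split => //.
- by apply: measurable_funM => //; exact: measurable_expRN_enorm.
- under eq_integral do rewrite EFinM.
  rewrite ge0_integralZl//.
  + apply: lte_mul_pinfty => //.
    by apply: integral_expRN_enorm_lty; rewrite invr_gt0 mulr_gt0.
  + by apply/measurable_EFinP; exact: measurable_expRN_enorm.
- move=> x th thM; rewrite (@le_trans _ _ (K * B x))//.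
    by rewrite ler_wpM2l//; exact: gB.
  rewrite BK ler_piMr// expR_le1 oppr_le0 mulr_ge0 ?sqr_ge0// invr_ge0.
  by lra.
- move=> x th th' thM thM'; rewrite /gauss -/K -mulrBr normrM (ger0_norm K0).
  rewrite (@le_trans _ _ (K * (`|enorm (x - th) ^+ 2 / s2 -
      enorm (x - th') ^+ 2 / s2| * B x)))//.
    by rewrite ler_wpM2l//; apply: expRN_lip; exact: gB.
  rewrite mulrCA BK.
  (* exp(- u) is the decay given up between [B] and [q]. It pays for the linear growth, since |x -
     th| + |x - th'| <= 2 |x| + 2 M <= 1 + |x|^2 + 2 M, which is 1 + 2 M + 4 s2 u and hence at most
     (1 + 2 M + 4 s2) exp u. *)
  set u := (4 * s2)^-1 * enorm x ^+ 2.
  have x0 := enorm_ge0 x.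
  have D0 := enorm_ge0 (th - th').
  have u0 : 0 <= u.
    by rewrite mulr_ge0 ?sqr_ge0// invr_ge0; lra.
  have ux : enorm x ^+ 2 = 4 * s2 * u by rewrite /u; field; lra.
  have h1 : `|enorm (x - th) ^+ 2 / s2 - enorm (x - th') ^+ 2 / s2| <=
      (1 + 2 * M + 4 * s2) / s2 * expR u * enorm (th - th').
    rewrite -mulrBl normrM (@ger0_norm _ s2^-1) ?invr_ge0 ?(ltW s20)//.
    have -> : (1 + 2 * M + 4 * s2) / s2 * expR u * enorm (th - th') =
        enorm (th - th') * ((1 + 2 * M + 4 * s2) * expR u) / s2 by field; lra.
    rewrite ler_pM2r ?invr_gt0// subr_sqr normrM.
    have d1 : `|enorm (x - th) - enorm (x - th')| <= enorm (th - th').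
      by rewrite (enormB x th) (enormB x th') enorm_dist_le.
    apply: ler_pM => //.
    have e0 := enorm_ge0 (x - th); have e0' := enorm_ge0 (x - th').
    rewrite ger0_norm ?addr_ge0//.
    have t1 := enormD x (- th); have t2 := enormD x (- th').
    rewrite !enormN in t1 t2.
    have eu := expR_ge1Dx u.
    have : 2 * enorm x <= 1 + enorm x ^+ 2.
      by have := sqr_ge0 (enorm x - 1); rewrite !expr2; nra.
    rewrite ux => hx.
    have : (1 + 2 * M + 4 * s2) * (1 + u) <= (1 + 2 * M + 4 * s2) * expR u.
      by rewrite ler_wpM2l//; lra.
    have := mulr_ge0 M0 u0.
    have := mulr_ge0 (ltW s20) u0.
    by nra.
  apply: le_trans (ler_wpM2r _ h1) _; first by rewrite mulr_ge0 ?expR_ge0.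
  rewrite le_eqVlt; apply/orP; left; apply/eqP.
  rewrite expRN; field; rewrite ?gt_eqF ?expR_gt0//.
Qed.

End gaussian_envelope.

(** * Supports and their components *)

Section support.
Context (R : realType) (d : nat).
Local Notation Rd := 'rV[R]_d.

(** Around each x in [A], half the radius of a ball missing [B] is a valid bound, and compactness
    makes it uniform. Stating it for all small r, rather than for some r, lets finitely many such
    bounds be intersected. *)
Lemma compact_closed_far (A B : set Rd) : compact A -> closed B ->
  A `&` B = set0 ->
  \forall r \near (0 : R)^'+, forall x y, A x -> B y -> r <= enorm (x - y).
Proof.
move=> cA cB AB.
suff : \forall r \near (0 : R)^'+, A `<=` [set x | forall y, B y -> r <= enorm (x - y)].
  by apply: filterS => r rP x y Ax; exact: rP.
apply: (compact_near_coveringP A).1 => // x Ax.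
have /open_enormP/(_ x)[|e e0 eB] := closed_openC cB.
  by move=> Bx; have : set0 x by rewrite -AB.
have e20 : 0 < e / 2 by rewrite divr_gt0.
exists (eball x (e / 2), [set r | r < e / 2]); [split|] => /=.
- apply: open_nbhs_nbhs; split; first exact: open_eball.
  by rewrite /eball /= subrr enorm0.
- exact: nbhs_right_lt.
- move=> [x' r] /= [/= x'x re] y By; rewrite /eball/= in x'x; rewrite leNgt; apply/negP => x'y.
  apply: (eB y) => //; have := enorm_triangle x' x y.
  by rewrite (enormB x x'); lra.
Qed.

Section probability_support.
Variable G : probability Rd R.

Lemma supp_closed : closed (supp G).
Proof. by apply: closed_bigI => C []. Qed.

Lemma supp_sub (C : set Rd) : closed C -> G C = 1%E -> supp G `<=` C.
Proof. by move=> cC GC x; apply. Qed.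

(** A Lindelöf argument: each point off the support lies in an open null set, hence in a null ball
    with rational centre and radius of the form 1/(n+1), and there are only countably many such
    balls. *)
Lemma supp_full : G (supp G) = 1%E.
Proof.
have mS : measurable (supp G) by apply: closed_measurable_rV; exact: supp_closed.
suff: G (~` supp G) = 0%E.
  by move=> h; rewrite -[supp G]setCK probability_setC ?h ?sube0//; exact: measurableC.
pose b (p : 'rV[rat]_d * nat) : set Rd := ball (map_mx ratr p.1 : Rd) p.2.+1%:R^-1.
(* Enumerates the null rational balls; an integer that codes no ball, or a ball of positive mass,
   yields the empty set. *)
pose F n : set Rd :=
  if (choice.unpickle n : option ('rV[rat]_d * nat)%type) is Some p then
    if G (b p) == 0%E then b p else set0 else set0.
have mb p : measurable (b p).
  have -> : b p = \bigcap_(i in [set: 'I_d]) ((fun x : Rd => x 0 i) @^-1`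
      ball (ratr (p.1 0 i) : R) p.2.+1%:R^-1).
    apply/seteqP; split => [x [_ px] i _|x px].
      by move: (px 0 i); rewrite !mxE.
    split=> [|i j]; first by rewrite invr_gt0 ltr0n.
    by rewrite !mxE ord1; exact: px.
  apply: fin_bigcap_measurable => // i _; rewrite -[X in measurable X]setTI.
  by apply: measurable_coord => //; exact: measurable_ball.
have : G.-negligible (\bigcup_n F n).
  apply: negligible_bigcup => n; rewrite /F.
  case: choice.unpickle => [p|]; last exact: negligible_set0.
  case: ifPn => [/eqP Gp|_]; last exact: negligible_set0.
  by apply/negligibleP => //; exact: mb.
suff sF : ~` supp G `<=` \bigcup_n F n.
  move=> /(negligibleS sF)/negligibleP; apply; exact: measurableC.
move=> x /existsNP[C] /not_implyP[[cC GC] Cx].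
have oC := closed_openC cC.
have : (~` C) x by [].
rewrite [X in X x](open_rV_bigcup_ball oC) => -[p /= pC xp].
exists (choice.pickle p) => //; rewrite /F choice.pickleK.
have mC := closed_measurable_rV cC.
have -> : G (b p) == 0%E.
  rewrite -measure_le0 (le_trans (le_measure G _ _ pC))//= ?inE//; [exact: mb|exact: measurableC|].
  have := probability_setC G mC; rewrite GC subee// => h.
  by rewrite -[leRHS]h.
exact: xp.
Qed.

(** Otherwise the complement of the ball would be a closed set of full mass missing y. *)
Lemma supp_eball_gt0 (y : Rd) (r : R) : supp G y -> 0 < r ->
  (0 < G (eball y r))%E.
Proof.
move=> Gy r0; rewrite lt0e measure_ge0 andbT; apply/eqP => U0.
have oU := @open_eball R d y r.
have := Gy (~` eball y r); rewrite /eball/= subrr enorm0; apply => //.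
split; first exact: open_closedC.
by rewrite probability_setC; [rewrite [X in (_ - X)%E]U0 sube0|exact: open_measurable_rV].
Qed.

(** The e-ball about z contains the (e/2)-ball about y when |z - y| < e/2, so the positive mass of
    the smaller ball bounds the mass for all z near y; compactness leaves finitely many bounds. *)
Lemma supp_eball_unif (e : R) : compact (supp G) -> 0 < e ->
  exists2 m : R, 0 < m & forall y, supp G y ->
    (m%:E <= G (eball y e))%E.
Proof.
move=> cS e0.
suff : \forall m \near (0 : R)^'+,
    supp G `<=` [set y | (m%:E <= G (eball y e))%E].
  move=> h; near (0 : R)^'+ => m; exists m; first by near: m; exact: nbhs_right_gt.
  by near: m.
apply: (compact_near_coveringP (supp G)).1 => // y Gy.
have e20 : 0 < e / 2 by rewrite divr_gt0.
have G0 := supp_eball_gt0 Gy e20.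
have mU z r : measurable (eball z r).
  by apply: open_measurable_rV; exact: open_eball.
have Gfin : G (eball y (e / 2)) \is a fin_num.
  exact: fin_num_measure.
exists (eball y (e / 2),
  [set m | m < fine (G (eball y (e / 2)))]); [split|] => /=.
- apply: open_nbhs_nbhs; split; first exact: open_eball.
  by rewrite /eball /= subrr enorm0.
- by apply: nbhs_right_lt; rewrite fine_gt0// G0 ltey_eq Gfin.
- move=> [z m] /= [/= zy my]; rewrite /eball/= in zy; rewrite (@le_trans _ _ (G (eball y (e / 2))))//.
    by rewrite -[leRHS]fineK// lee_fin ltW.
  apply: le_measure; rewrite ?inE// => x; rewrite /eball/= => xy.
  by have := enorm_triangle y x z; rewrite (enormB y z); lra.
Unshelve. all: by end_near. Qed.

End probability_support.

(** * Connected components of the support, finite in number *)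

Section components_of_support.
Variables (G : probability Rd R) (N : nat) (S : 'I_N -> set Rd).
Hypothesis S_comp : set_bij [set: 'I_N] (components (supp G)) S.

Lemma component_ex k : exists2 x, supp G x & S k = connected_component (supp G) x.
Proof. by have [SC _ _] := S_comp; have [//|x Gx xS] := SC k; exists x. Qed.

Lemma component_sub k : S k `<=` supp G.
Proof. by have [x _ ->] := component_ex k; exact: connected_component_sub. Qed.

Lemma component_conn k : connected (S k).
Proof. by have [x _ ->] := component_ex k; exact: component_connected. Qed.

Lemma component_nonempty k : S k !=set0.
Proof.
have [x Gx ->] := component_ex k; exists x; exact: connected_component_refl.
Qed.

Lemma component_cl k : closed (S k).
Proof.
by have [x _ ->] := component_ex k; apply: component_closed; exact: supp_closed.
Qed.

Lemma component_cover x : supp G x -> exists k, S k x.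
Proof.
have [_ _ SS] := S_comp; move=> Gx.
have [|k _ kx] := SS (connected_component (supp G) x); first by exists x.
by exists k; rewrite kx; exact: connected_component_refl.
Qed.

Lemma component_uniq k j x : S k x -> S j x -> k = j.
Proof.
have [_ SI _] := S_comp; move=> kx jx; apply: SI; rewrite ?inE//.
move: kx jx; have [y _ ->] := component_ex k; have [z _ ->] := component_ex j.
by move=> yx zx; rewrite (same_connected_component yx) (same_connected_component zx).
Qed.

Lemma component_count_gt0 : (0 < N)%N.
Proof.
have [x Gx] : supp G !=set0.
  apply/set0P/eqP => G_0; have := supp_full G; rewrite G_0 measure0 => /eqP.
  by rewrite eqe eq_sym oner_eq0.
by have [k _] := component_cover Gx; exact: leq_ltn_trans (ltn_ord k).
Qed.

(** Finiteness of the number of components makes the union of the others closed. If [S k] were null,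
    that union would have full mass and would contain the support, hence [S k], which is disjoint
    from it. *)
Lemma component_gt0 k : (0 < G (S k))%E.
Proof.
rewrite lt0e measure_ge0 andbT; apply/eqP => Gk.
have mS j : measurable (S j) by apply: closed_measurable_rV; exact: component_cl.
have [x kx] := component_nonempty k.
pose C := \bigcup_(j in [set j | j != k]) S j.
have cC : closed C.
  apply: closed_bigcup => [|j _]; [exact: finite_finset|exact: component_cl].
have TC : supp G `\` S k `<=` C.
  move=> y [/component_cover[j jy] ky]; exists j => //=.
  by apply/eqP => jk; apply: ky; rewrite -jk.
have mT := closed_measurable_rV (@supp_closed G).
have mC := closed_measurable_rV cC.
have GC : G C = 1%E.
  apply/eqP; rewrite eq_le probability_le1//=.
  have <- : G (supp G `\` S k) = 1%E.
    rewrite measureD//; last by rewrite -ge0_fin_numE// fin_num_measure.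
    by rewrite (setIidr (@component_sub k)) [X in (_ - X)%E]Gk sube0; exact: supp_full.
  by apply: le_measure => //; rewrite inE//; exact: measurableD.
have [j /= /eqP jk jx] := supp_sub cC GC (component_sub kx).
by apply: jk; exact: component_uniq jx kx.
Qed.

Lemma components_separated : compact (supp G) ->
  exists2 rho : R, 0 < rho &
    forall k j x y, k != j -> S k x -> S j y -> rho <= enorm (x - y).
Proof.
move=> cG.
suff : \forall r \near (0 : R)^'+, forall kj : 'I_N * 'I_N, kj.1 != kj.2 ->
    forall x y, S kj.1 x -> S kj.2 y -> r <= enorm (x - y).
  move=> h; near (0 : R)^'+ => r; exists r.
    by near: r; exact: nbhs_right_gt.
  by move=> k j x y kj; apply: (near h r _ (k, j)).
apply: filter_forall => -[k j] /=.
have [_|kj] := eqVneq k j; first by apply: nearW.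
have cSk : compact (S k).
  apply: (subclosed_compact _ cG); [exact: component_cl|exact: component_sub].
have disj : S k `&` S j = set0.
  apply/seteqP; split => // x [kx jx].
  by move: kj; rewrite (component_uniq kx jx) eqxx.
have h := compact_closed_far cSk (@component_cl j) disj.
by near=> r => _; near: r.
Unshelve. all: by end_near. Qed.

End components_of_support.

End support.

(** * Single-linkage clustering *)

Lemma fset_set_card_ge (T : choiceType) (C : set T) (N : nat) (f : 'I_N -> T) :
  finite_set C -> injective f -> (forall k, C (f k)) ->
  (N <= #|` fset_set C|)%N.
Proof.
move=> fC fI Cf; have <- : size [seq f k | k <- enum 'I_N] = N.
  by rewrite size_map size_enum_ord.
apply: uniq_leq_size; first by rewrite map_inj_uniq// enum_uniq.
by move=> _ /mapP[k _ ->]; rewrite in_fset_set// inE; exact: Cf.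
Qed.

Lemma fset_set_card_le (T : choiceType) (C : set T) (N : nat) (g : T -> 'I_N) :
  finite_set C -> {in C &, injective g} -> (#|` fset_set C| <= N)%N.
Proof.
move=> fC gI; rewrite -[X in (_ <= X)%N]card_ord.
rewrite -(size_map g) (leq_trans _ (max_card (mem [seq g i | i <- fset_set C])))//.
rewrite (card_uniqP _)// map_inj_in_uniq ?fset_uniq// => x y.
by rewrite !in_fset_set//; exact: gI.
Qed.

Lemma finite_set_min (R : realType) (T : choiceType) (F : set T)
    (f : T -> \bar R) :
  finite_set F -> F !=set0 -> exists2 x, F x & forall y, F y -> (f x <= f y)%E.
Proof.
move=> /finite_seqP[s ->]; elim: s => [[x]//|a s IH _].
have [->|s0] := eqVneq s [::].
  by exists a => [|y /=]; rewrite /= inE// => /eqP ->.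
have [|x xs xmin] := IH.
  by case: s s0 {IH} => // b s _; exists b; rewrite /= inE eqxx.
have [ax|xa] := leP (f a) (f x).
  exists a => [|y]; rewrite /= inE ?eqxx// => /predU1P[->//|ys].
  exact: le_trans ax (xmin _ ys).
exists x => [|y]; rewrite /= inE; first by rewrite [x \in s]xs orbT.
by move=> /predU1P[->|]; [exact: ltW|exact: xmin].
Qed.

Lemma open_separated (T : topologicalType) (U V : set T) :
  open U -> open V -> U `&` V = set0 -> separated U V.
Proof.
have H (A B : set T) : open B -> A `&` B = set0 -> closure A `&` B = set0.
  move=> oB AB; apply/seteqP; split => // z [cAz Bz].
  have [|w] := cAz B; first exact: open_nbhs_nbhs.
  by rewrite AB.
by move=> oU oV UV; split; [|rewrite setIC]; apply: H => //; rewrite setIC.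
Qed.

Section clustering.
Context (R : realType) (d : nat).
Local Notation Rd := 'rV[R]_d.

(** A partition of [L] into finitely many nonempty sets. *)
Definition is_clustering (L : set Rd) (C : set (set Rd)) : Prop :=
  [/\ finite_set C, (forall A, C A -> A !=set0), (forall A, C A -> A `<=` L),
    (forall x, L x -> exists2 A, C A & A x) &
    (forall A B, C A -> C B -> A `&` B !=set0 -> A = B)].

Lemma components_clustering (L : set Rd) :
  finite_set (components L) -> is_clustering L (components L).
Proof.
move=> fL; split => //.
- by move=> _ [x Lx <-]; exists x; exact: connected_component_refl.
- by move=> _ [x Lx <-]; exact: connected_component_sub.
- move=> x Lx; exists (connected_component L x); first by exists x.
  exact: connected_component_refl.
- move=> _ _ [x Lx <-] [y Ly <-] [z [xz yz]].
  by rewrite (same_connected_component xz) (same_connected_component yz).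
Qed.

Lemma merge_clustering (L : set Rd) (C C' : set (set Rd)) :
  is_clustering L C -> merge_step C C' ->
  is_clustering L C' /\ (#|` fset_set C'|.+1 = #|` fset_set C|)%N.
Proof.
move=> [fC C0 CL LC Cdisj] [A [B [CA CB AB _ ->]]].
have CAB D : C D -> D <> A -> D <> B -> D `&` (A `|` B) = set0.
  move=> CD DA DB; apply: contrapT => /eqP/set0P[x [Dx [Ax|Bx]]].
    by apply: DA; apply: Cdisj => //; exists x.
  by apply: DB; apply: Cdisj => //; exists x.
have fAB : finite_set [set A; B] by exact: finite_set2.
have fD : finite_set (C `\` [set A; B]) by exact: finite_setD.
split.
  split.
  - by rewrite finite_setU; split.
  - move=> D [[CD _]|->]; first exact: C0.
    by have [x Ax] := C0 _ CA; exists x; left.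
  - move=> D [[CD _]|->]; first exact: CL.
    by move=> x [Ax|Bx]; [exact: (CL A)|exact: (CL B)].
  - move=> x /LC[D CD Dx].
    have [DAB|DAB] := pselect ([set A; B] D).
      by exists (A `|` B); [right|case: DAB => <-; [left|right]].
    by exists D => //; left.
  - move=> D E [[CD nD]|->] [[CE nE]|->] //; first exact: Cdisj.
    + rewrite CAB//; first by case.
      * by move=> DA; apply: nD; left.
      * by move=> DA; apply: nD; right.
    + rewrite setIC CAB//; first by case.
      * by move=> DA; apply: nE; left.
      * by move=> DA; apply: nE; right.
(* The union is not already among the remaining clusters, since it meets [A]; hence the count drops
   by exactly one. *)
have nAB : (A `|` B) \notin fset_set (C `\` [set A; B]).
  rewrite in_fset_set// notin_setE => -[CU /= nU].
  have [x Ax] := C0 _ CA.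
  by apply: nU; left; apply: Cdisj => //; exists x; split => //; left.
rewrite fset_setU// fset_set1 fsetUC cardfsU1 nAB/= fset_setD//.
rewrite cardfsD fset_setU// !fset_set1.
set X := fset_set C.
have sX : ([fset A] `|` [fset B] `<=` X)%fset.
  by apply/fsubsetP => D; rewrite !inE in_fset_set// inE => /orP[] /eqP ->.
rewrite (fsetIidPr sX).
have c2 : #|` ([fset A] `|` [fset B])%fset| = 2%N.
  by rewrite cardfs2; case: eqP AB.
have := fsubset_leq_card sX; rewrite c2 => h.
by rewrite add1n; move: h; case: #|` X| => // -[]// n _; rewrite subSS subn1.
Qed.

Lemma merge_exists (L : set Rd) (C : set (set Rd)) :
  is_clustering L C -> (1 < #|` fset_set C|)%N -> exists C', merge_step C C'.
Proof.
move=> [fC _ _ _ _] C1.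
pose F := [set p : set Rd * set Rd | [/\ C p.1, C p.2 & p.1 <> p.2]].
have fF : finite_set F.
  by apply: (sub_finite_set _ (finite_setX fC fC)) => p [].
have [|[A B] [CA CB AB] minAB] :=
    @finite_set_min R _ F (fun p => setdist p.1 p.2) fF.
  have /fset0Pn[A XA] : fset_set C != fset0 by rewrite -cardfs_gt0 ltnW.
  have /fset0Pn[B] : (fset_set C `\ A)%fset != fset0.
    by move: C1; rewrite (cardfsD1 A) XA add1n ltnS cardfs_gt0.
  rewrite !inE => /andP[/eqP BA XB].
  by exists (A, B); split; [move: XA|move: XB|exact: nesym];
    rewrite in_fset_set// inE.
exists ((C `\` [set A; B]) `|` [set A `|` B]), A, B; split => //.
by move=> A' B' CA' CB' AB'; apply: (minAB (A', B')).
Qed.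

(** * Single linkage on a set close to well-separated connected sets *)

Section well_separated.
Context (N : nat) (L : set Rd) (S : 'I_N -> set Rd) (eps rho : R).
Hypotheses (eps0 : 0 < eps) (rho_eps : 8 * eps <= rho).
Hypothesis LS : forall x, L x -> exists k, nbd (S k) eps x.
Hypothesis SL : forall k y, S k y -> exists2 x, L x & enorm (x - y) < eps.
Hypothesis Ssep : forall k j x y, k != j -> S k x -> S j y -> rho <= enorm (x - y).
Hypothesis Scon : forall k, connected (S k).
Hypothesis S0 : forall k, S k !=set0.
Hypothesis Lfin : finite_set (components L).

(** The invariant of the merging process: no cluster straddles two of the sets [S k]. *)
Definition grouped (C : set (set Rd)) : Prop :=
  forall A, C A -> exists k, A `<=` nbd (S k) eps.

Lemma nbd_sep k j x y : nbd (S k) eps x -> nbd (S j) eps y ->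
  enorm (x - y) < rho - 2 * eps -> k = j.
Proof.
move=> [a ka xa] [b jb yb] xy; apply: contrapT => /eqP kj.
have := Ssep kj ka jb; have := enorm_triangle x a b.
by have := enorm_triangle y x b; rewrite (enormB a x); lra.
Qed.

Lemma nbd_inj k j x : nbd (S k) eps x -> nbd (S j) eps x -> k = j.
Proof.
move=> kx jx; apply: (nbd_sep kx jx).
by rewrite subrr enorm0; move: eps0 rho_eps; lra.
Qed.

(** A connected piece contained in the union of two disjoint open sets, the neighbourhood of [S k]
    and that of all the other [S j], lies in one of them. *)
Lemma components_grouped : grouped (components L).
Proof.
move=> _ [x /LS[k kx] <-]; exists k.
pose V := \bigcup_(j in [set j | j != k]) nbd (S j) eps.
have [|||//|sV] := @connected_subset _ (nbd (S k) eps) V (connected_component L x).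
- apply: open_separated; [exact: open_nbd|apply: bigcup_open => j _; exact: open_nbd|].
  by apply/seteqP; split => // y [ky [j /= /eqP jk jy]]; apply: jk; exact: nbd_inj jy ky.
- move=> y /connected_component_sub/LS[j jy].
  by have [jk|jk] := eqVneq j k; [left; rewrite -jk|right; exists j].
- exact: component_connected.
have [Lx|nLx] := pselect (L x); last by rewrite connected_component_out.
have [j /= /eqP jk jx] := sV _ (connected_component_refl Lx).
by exfalso; apply: jk; exact: nbd_inj jx kx.
Qed.

Lemma cluster_near C k : is_clustering L C ->
  exists2 A, C A & exists2 x, A x & nbd (S k) eps x.
Proof.
move=> [_ _ _ LC _]; have [y ky] := S0 k; have [x Lx xy] := SL ky.
by have [A CA Ax] := LC _ Lx; exists A => //; exists x => //; exists y.
Qed.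

(** Picking for each k a cluster that meets the neighbourhood of [S k] is injective, since a grouped
    cluster cannot meet two such neighbourhoods. *)
Lemma grouped_card_ge C : is_clustering L C -> grouped C ->
  (N <= #|` fset_set C|)%N.
Proof.
move=> clC gC.
have /choice[f fP] k : exists A, C A /\ exists2 x, A x & nbd (S k) eps x.
  by have [A CA Ak] := cluster_near k clC; exists A.
have [fC _ _ _ _] := clC; apply: (fset_set_card_ge fC (f := f)).
  move=> k j fkj; have [Ck [x kx Skx]] := fP k; have [Cj [y jy Sjy]] := fP j.
  have [i fi] := gC _ Ck; rewrite (nbd_inj Skx (fi _ kx)).
  by rewrite fkj in fi; rewrite (nbd_inj Sjy (fi _ jy)).
by move=> k; case: (fP k).
Qed.

(* If two clusters lie near the same connected set S k, the clusters cannot all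
   be 2 eps apart, since their eps-neighbourhoods cover S k. *)
Lemma close_pair C : is_clustering L C -> grouped C ->
  (N < #|` fset_set C|)%N ->
  exists A B, [/\ C A, C B, A <> B & (setdist A B < (2 * eps)%:E)%E].
Proof.
move=> [fC C0 CL LC Cdisj] gC NC; apply: contrapT => far.
have {}far A B a b : C A -> C B -> A <> B -> A a -> B b -> 2 * eps <= enorm (a - b).
  move=> CA CB AB Aa Bb; rewrite leNgt; apply/negP => ab.
  apply: far; exists A, B; split => //.
  apply: le_lt_trans (_ : ((enorm (a - b))%:E < _)%E); last by rewrite lte_fin.
  by apply: ereal_inf_lbound; exists (a, b).
(* With no index at all, a cluster cannot be grouped; otherwise the index 0 serves as default value
   of the choice function [g]. *)
have [N0|N0] := posnP N.
  have [A CA] : C !=set0.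
    apply/set0P/eqP => C_0; move: NC; rewrite C_0 fset_set0 cardfs0.
    by rewrite ltn0.
  by have [k _] := gC _ CA; move: (ltn_ord k); rewrite [X in (_ < X)%N]N0.
have /choice[g gP] A : exists k, C A -> A `<=` nbd (S k) eps.
  have [/gC[k Ak]|nA] := pselect (C A); first by exists k.
  by exists (Ordinal N0).
(* Pigeonhole: there are more clusters than sets [S k], so two clusters lie near the same one. *)
have [A [B [CA CB AB gAB]]] : exists A B, [/\ C A, C B, A <> B & g A = g B].
  apply: contrapT => ninj; move: NC; rewrite ltnNge => /negP; apply.
  apply: (fset_set_card_le fC (g := g)) => A B; rewrite !inE => CA CB gAB.
  by apply: contrapT => AB; apply: ninj; exists A, B.
pose k := g A.
(* [W] gathers all clusters other than [A]. If clusters were 2 eps apart, the eps-neighbourhoods of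
   [A] and [W] would be disjoint open sets covering [S k], and both meet it: the first because of
   [A], the second because of [B]. *)
pose W := \bigcup_(D in C `\ A) D.
have touch D a : D a -> D `<=` nbd (S k) eps -> exists2 y, S k y & nbd D eps y.
  move=> Da /(_ _ Da)[y ky ay]; exists y => //.
  by exists a => //; rewrite enormB.
have disj : nbd A eps `&` nbd W eps = set0.
  apply/seteqP; split => // z [[a Aa za] [b [D [CD DA] Db] zb]].
  have := far _ _ _ _ CA CD (nesym DA) Aa Db.
  by have := enorm_triangle z a b; rewrite (enormB a z); lra.
have [a Aa] := C0 _ CA; have [b Bb] := C0 _ CB.
have [y ky yA] := touch _ _ Aa (gP _ CA).
have kB : B `<=` nbd (S k) eps by rewrite /k gAB; exact: gP.
have [y' ky' [b' Bb' yb']] := touch _ _ Bb kB.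
have yW : nbd W eps y'.
  by exists b' => //; exists B => //; split => // BA; apply: AB.
have [|||sk|sk] := @connected_subset _ (nbd A eps) (nbd W eps) (S k).
- by apply: open_separated => //; exact: open_nbd.
- move=> z /SL[x Lx xz]; have [D CD Dx] := LC _ Lx.
  have [DA|DA] := pselect (D = A).
    by left; exists x; [rewrite -DA|rewrite enormB].
  by right; exists x; [exists D|rewrite enormB].
- exact: Scon.
- by have : set0 y' by rewrite -disj; split => //; exact: sk.
- by have : set0 y by rewrite -disj; split => //; exact: sk.
Qed.

(** The merged pair is at least as close as the pair given by [close_pair], so it has points at
    distance below 2 eps <= rho - 2 eps, which forces both clusters to lie near the same [S k]. *)
Lemma merge_grouped C C' : is_clustering L C -> grouped C ->
  (N < #|` fset_set C|)%N -> merge_step C C' -> grouped C'.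
Proof.
move=> clC gC NC [A [B [CA CB AB minAB ->]]] D [[CD _]|->]; first exact: gC.
have [A' [B' [CA' CB' AB' dAB']]] := close_pair clC gC NC.
have /ereal_inf_lt[_ [[a b] [/= Aa Bb] <-]] :=
  le_lt_trans (minAB _ _ CA' CB' AB') dAB'.
rewrite lte_fin => ab.
have [k Ak] := gC _ CA; have [j Bj] := gC _ CB.
have kj : k = j by apply: (nbd_sep (Ak _ Aa) (Bj _ Bb)); move: eps0 rho_eps ab; lra.
by exists k => x [/Ak//|/Bj]; rewrite kj.
Qed.

(** Merging may run past N clusters and then joins different [S k], so grouping is claimed only
    while at least N clusters remain. *)
Lemma merges_inv C : merges (components L) C ->
  is_clustering L C /\ ((N <= #|` fset_set C|)%N -> grouped C).
Proof.
elim=> [|C1 C2 _ [clC1 gC1] C12].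
  by split => [|_]; [exact: components_clustering|exact: components_grouped].
have [clC2 C21] := merge_clustering clC1 C12; split => // NC2.
have NC1 : (N < #|` fset_set C1|)%N by rewrite -C21.
by apply: merge_grouped C12 => //; apply: gC1; exact: ltnW.
Qed.

Lemma single_linkage_exists : (0 < N)%N ->
  exists S' : 'I_N -> set Rd, single_linkage L S'.
Proof.
move=> N0.
have clL := components_clustering Lfin.
have NL := grouped_card_ge clL components_grouped.
(* Induction on the number m of merges. Since 0 < N, the bound on the count excludes truncation in
   the subtraction and leaves two clusters to merge at each stage. *)
have H m : (N <= #|` fset_set (components L)| - m)%N ->
    exists2 C, merges (components L) C &
      #|` fset_set C| = (#|` fset_set (components L)| - m)%N.
  elim: m => [_|m IH Nm].
    by exists (components L); [exact: merges_refl|rewrite subn0].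
  have [|C mC Cm] := IH; first by apply: leq_trans Nm _; rewrite leq_sub2l.
  have [clC _] := merges_inv mC.
  have [|C' CC'] := merge_exists clC.
    rewrite Cm; apply: (@leq_ltn_trans (#|` fset_set (components L)| - m.+1)).
      exact: leq_trans N0 Nm.
    rewrite subnS ltn_predL; have := leq_trans N0 Nm.
    by rewrite subnS; case: (_ - m)%N.
  have [clC' C'C] := merge_clustering clC CC'.
  exists C'; first exact: merges_step CC'.
  by apply: succn_inj; rewrite C'C Cm subnS prednK//; have := leq_trans N0 Nm;
    rewrite subnS; case: (_ - m)%N.
have [|C mC] := H (#|` fset_set (components L)| - N)%N.
  by rewrite subKn.
rewrite subKn// => CN.
have [[fC _ _ _ _] _] := merges_inv mC.
pose s := enum_fset (fset_set C).
have sN : size s = N by exact: CN.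
exists (fun k => nth set0 s k); exists C => //; split.
- move=> k _; have : nth set0 s k \in fset_set C.
    by apply: mem_nth; rewrite sN.
  by rewrite in_fset_set// inE.
- move=> k j _ _ /eqP; rewrite nth_uniq ?sN// ?fset_uniq// => /eqP kj.
  exact: val_inj.
- move=> A CA; have As : A \in s by rewrite /s in_fset_set// inE.
  have Ai : (index A s < N)%N by rewrite -sN index_mem.
  by exists (Ordinal Ai) => //=; rewrite nth_index.
Qed.

(** The N final clusters are grouped. Sending k to the index of a cluster near [S k] is an injective
    self-map [h] of the indices, hence a permutation; so each point of [L] near [S k] lies in a
    cluster indexed by some h(j), and disjointness of the neighbourhoods gives j = k. *)
Lemma single_linkage_match (Sh : 'I_N -> set Rd) : single_linkage L Sh ->
  exists s : {perm 'I_N}, forall k, Sh (s k) = L `&` nbd (S k) eps.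
Proof.
move=> [C mC [ShC ShI ShS]].
have [clC gC] := merges_inv mC.
have [fC C0 CL LC Cdisj] := clC.
have {}gC : grouped C.
  apply: gC; apply: (fset_set_card_ge fC (f := Sh)) => [k j|k].
    by move=> /ShI; apply; rewrite inE.
  exact: ShC.
have /choice[h hP] k : exists i, Sh i `<=` nbd (S k) eps.
  have [A CA [x Ax kx]] := cluster_near k clC.
  have [i _ iA] := ShS _ CA; exists i; rewrite iA.
  have [j Aj] := gC _ CA.
  by rewrite (nbd_inj kx (Aj _ Ax)).
have hI : injective h.
  move=> k j hkj; have [x hx] := C0 _ (ShC (h k) I).
  by apply: (@nbd_inj _ _ x); [exact: hP|apply: hP; rewrite -hkj].
exists (perm hI) => k; rewrite permE; apply/seteqP; split => [x hx|x [Lx kx]].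
  by split; [exact: (CL (Sh (h k)) (ShC _ I))|exact: hP].
have [A CA Ax] := LC _ Lx; have [i _ iA] := ShS _ CA.
have /codomP[j ij] : i \in codom h by rewrite (inj_card_onto hI).
move: Ax; rewrite -iA ij => jx.
by rewrite (nbd_inj kx (hP _ _ jx)).
Qed.

End well_separated.

End clustering.

(** * Level sets of box-smoothed measures *)

Section level_sets.
Context (R : realType) (d : nat).
Local Notation Rd := 'rV[R]_d.
Implicit Types (x y : Rd).

(** The closed cube, unlike the open [ball], so that it is exactly the support of the translated box
    kernel. *)
Definition cbox x (r : R) : set Rd := [set z | forall i, `|x 0 i - z 0 i| <= r].

Lemma measurable_cbox x (r : R) : measurable (cbox x r).
Proof.
have -> : cbox x r = \bigcap_(i in [set: 'I_d])
    ((fun z : Rd => z 0 i) @^-1` [set` `[x 0 i - r, x 0 i + r]]).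
  apply/seteqP; split => z /= zr i; last first.
    by move: (zr i I); rewrite /= in_itv/= distrC ler_distl.
  by move=> _ /=; rewrite in_itv/= -ler_distl distrC.
apply: fin_bigcap_measurable => // i _; rewrite -[X in measurable X]setTI.
exact: measurable_coord.
Qed.

Lemma convm_box (G : probability Rd R) (delta : R) x : 0 < delta ->
  convm (box delta) G x = (2 * delta) ^- d * fine (G (cbox x delta)).
Proof.
move=> d0; rewrite /convm.
have c0 : 0 <= (2 * delta) ^- d by rewrite invr_ge0 exprn_ge0 ?mulr_ge0 ?ltW.
rewrite (eq_integral (fun th : Rd =>
    ((2 * delta) ^- d)%:E * (\1_(cbox x delta) th)%:E)%E); last first.
  move=> th _; rewrite /box EFinM !indicE; congr (_ * ((nat_of_bool _)%:R)%:E)%E.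
  by apply/idP/idP; rewrite !inE => h i; move: (h i); rewrite !mxE.
rewrite ge0_integralZl//.
  by rewrite integral_indic ?setIT ?fineM ?fin_num_measure//; exact: measurable_cbox.
by apply/measurable_EFinP; apply: measurable_indic; exact: measurable_cbox.
Qed.

Lemma integral_mindic (G : probability Rd R) (A : set Rd) : measurable A ->
  (\int[G]_x (\1_A x)%:E = G A)%E.
Proof. by move=> mA; rewrite integral_indic ?setIT. Qed.

(** Mass leaving [A] either lands outside [U] or travels at least r. The test functions are r times
    the indicators of [A] and of the complement of [U]; for [U] the whole space this is a Markov
    bound. *)
Lemma coupling_mass_fst (G G' : probability Rd R) (gam : probability (Rd * Rd)%type R)
    (A B U : set Rd) (r : R) :
  couplings G G' gam -> measurable A -> measurable B -> measurable U ->
  G' B = 1%E -> 0 <= r ->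
  (forall x y, A x -> U y -> B y -> r <= enorm (x - y)) ->
  (r%:E * G A <= r%:E * G' (~` U) + \int[gam]_z (enorm (z.1 - z.2))%:E)%E.
Proof.
move=> gamP mA mB mU G'B r0 far.
have mAr (r' : R) (D : set Rd) : measurable D -> measurable_fun setT (fun x => r' * \1_D x).
  by move=> mD; apply: measurable_funM => //; exact: measurable_indic.
have := @coupling_le_fst _ _ G G' gam gamP setT B
  (fun x => r * \1_A x) (fun x => r * \1_(~` U) x) 1.
rewrite mul1e => /(_ measurableT mB (probability_setT G) G'B (mAr _ _ mA)
  (mAr _ _ (measurableC mU))).
have Ir D : measurable D -> forall H : probability Rd R,
    (\int[H]_x (r * \1_D x)%:E = r%:E * H D)%E.
  move=> mD H; under eq_integral do rewrite EFinM.
  rewrite ge0_integralZl// ?integral_mindic//.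
  by apply/measurable_EFinP; exact: measurable_indic.
rewrite !Ir//; last exact: measurableC.
apply => // [x|x|x y _ By]; [by rewrite mulr_ge0|by rewrite mulr_ge0|].
rewrite mul1r !indicE; have e0 := enorm_ge0 (x - y).
have [Ax|_] := boolP (x \in A); last first.
  by rewrite mulr0 addr_ge0// mulr_ge0.
rewrite mulr1; have [Uy|nUy] := boolP (y \in ~` U); first by rewrite mulr1 lerDl.
rewrite mulr0 add0r; apply: far; rewrite ?inE in Ax * => //.
by move: nUy; rewrite notin_setE => /contrapT.
Qed.

(** Mass arriving in the ball of radius r from outside the cube of half-side 2 r has travelled more
    than r. *)
Lemma coupling_mass_snd (G G' : probability Rd R) (gam : probability (Rd * Rd)%type R)
    (y : Rd) (r : R) :
  couplings G G' gam -> 0 < r ->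
  (G' (eball y r) <= G (cbox y (2 * r))
     + r^-1%:E * \int[gam]_z (enorm (z.1 - z.2))%:E)%E.
Proof.
move=> gamP r0.
have mb : measurable (eball y r) by apply: open_measurable_rV; exact: open_eball.
have mc := measurable_cbox y (2 * r).
rewrite -(integral_mindic _ mb) -(integral_mindic _ mc).
apply: (coupling_le_snd gamP measurableT measurableT) => //.
- exact: probability_setT.
- exact: probability_setT.
- by rewrite invr_ge0 ltW.
- move=> x z _ _; have e0 := enorm_ge0 (x - z).
  have e0' : 0 <= r^-1 * enorm (x - z) by rewrite mulr_ge0// invr_ge0 ltW.
  rewrite !indicE; have [|_] := boolP (z \in _); last by rewrite addr_ge0.
  rewrite inE /eball/= => zy.
  have [_|] := boolP (x \in _); first by rewrite lerDl.
  rewrite notin_setE => /existsNP[i /negP]; rewrite -ltNge => hi.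
  rewrite add0r mulrC ler_pdivlMr// mul1r.
  have := coord_le_enorm (y - x) i; rewrite !mxE => h.
  by have := enorm_triangle z x y; rewrite (enormB x y); lra.
Qed.

Lemma measure_bigsetU_le (G : probability Rd R) (I : Type) (s : seq I)
    (F : I -> set Rd) (c : R) : (forall i, measurable (F i)) ->
  (forall i, (G (F i) <= c%:E)%E) ->
  (G (\big[setU/set0]_(i <- s) F i) <= ((size s)%:R * c)%:E)%E.
Proof.
move=> mF Fc; elim: s => [|i s IH]; first by rewrite big_nil measure0 mul0r.
rewrite big_cons; apply: (le_trans (measureU2 _ _ _)) => //.
  exact: bigsetU_measurable.
by rewrite /= -natr1 mulrDl mul1r addrC EFinD leeD.
Qed.

(* The cube of half-side r is covered by (r / delta + 1)^d boxes of half-side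
   delta. *)
Lemma cube_mass_le (G : probability Rd R) y (r delta c : R) :
  0 < r -> 0 < delta -> 0 <= c ->
  (forall x, (forall i, `|x 0 i - y 0 i| <= r + delta) ->
    (G (cbox x delta) <= ((2 * delta) ^+ d * c)%:E)%E) ->
  (G (cbox y r) <= ((2 * r + 2 * delta) ^+ d * c)%:E)%E.
Proof.
move=> r0 d0 c0 small.
(* The number of boxes per axis: [K] intervals of length 2 delta cover one of length 2 r and
   overshoot it by at most 2 delta. *)
pose K := (Num.truncn (r / delta)).+1.
have rd0 : 0 <= r / delta by rewrite divr_ge0 ?ltW.
have rK : r / delta < K%:R by rewrite truncnS_gt.
have Kr : K%:R * delta <= r + delta.
  rewrite /K -natr1 mulrDl mul1r lerD2r -ler_pdivlMr//.
  by have /andP[] := truncn_itv rd0.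
(* In each coordinate, the midpoint of the interval numbered [f i] among those of length 2 delta
   laid end to end from y - r. *)
pose ctr (f : {ffun 'I_d -> 'I_K}) : Rd :=
  \row_i (y 0 i - r + delta * (2 * (f i)%:R + 1)).
have cover : cbox y r `<=` \big[setU/set0]_f cbox (ctr f) delta.
  move=> z zy.
  pose u i := (z 0 i - y 0 i + r) / (2 * delta).
  have u0 i : 0 <= u i.
    rewrite divr_ge0 ?mulr_ge0 ?(ltW d0)//.
    by have := zy i; rewrite ler_norml => /andP[? ?]; lra.
  have uK i : (Num.truncn (u i) < K)%N.
    rewrite truncn_lt_nat//; apply: le_lt_trans rK.
    rewrite ler_pdivrMr ?mulr_gt0// [leRHS](_ : _ = 2 * r).
      by have := zy i; rewrite ler_norml => /andP[? ?]; lra.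
    by field; lra.
  rewrite -bigcup_seq; exists [ffun i => Ordinal (uK i)] => /=.
    exact: mem_index_enum.
  move=> i; rewrite mxE ffunE/=.
  have /andP[h1 h2] := truncn_itv (u0 i).
  have zu : z 0 i = y 0 i - r + 2 * delta * u i by rewrite /u; field; lra.
  rewrite zu ler_norml; move: h1 h2; rewrite -natr1.
  set a : R := (Num.truncn (u i))%:R; set b := u i => h1 h2.
  have : 0 <= delta * (b - a) by rewrite mulr_ge0 ?subr_ge0 ?(ltW d0) ?(ltW h2).
  have : 0 <= delta * (a + 1 - b) by rewrite mulr_ge0 ?subr_ge0 ?(ltW d0) ?(ltW h2).
  by move=> ? ?; apply/andP; split; lra.
apply: le_trans (le_measure G _ _ cover) _; rewrite ?inE.
- exact: measurable_cbox.
- by apply: bigsetU_measurable => f _; exact: measurable_cbox.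
apply: (le_trans (measure_bigsetU_le _ (c := (2 * delta) ^+ d * c) _ _)).
- by move=> f; exact: measurable_cbox.
- move=> f; apply: small => i; rewrite mxE.
  have fK : (f i)%:R + 1 <= K%:R :> R by rewrite natr1 ler_nat ltn_ord.
  have : delta * ((f i)%:R + 1) <= K%:R * delta by rewrite mulrC ler_pM2r.
  have : 0 <= delta * (f i)%:R by rewrite mulr_ge0// ltW.
  by move=> ? ?; rewrite ler_norml; apply/andP; split; lra.
rewrite lee_fin mulrA ler_wpM2r//.
have -> : size (index_enum {ffun 'I_d -> 'I_K}) = (K ^ d)%N.
  by rewrite -sum1_size sum1_card card_ffun !card_ord.
rewrite natrX -exprMn lerXn2r ?nnegrE ?mulr_ge0 ?addr_ge0 ?mulr_ge0 ?(ltW d0) ?(ltW r0)//.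
by move: Kr; lra.
Qed.

Section one_estimate.
Variables (G Gs : probability Rd R) (delta t : R).
Hypotheses (d_gt0 : (0 < d)%N) (delta0 : 0 < delta) (t0 : 0 < t).
Hypothesis t_ge : ((2 ^- d * delta ^- d.+1 / Num.sqrt d%:R)%:E *
  wasserstein1 G Gs <= t%:E)%E.

Let sd0 : 0 < Num.sqrt d%:R :> R.
Proof. by rewrite sqrtr_gt0 ltr0n. Qed.

Let k0 : 0 < 2 ^- d * delta ^- d.+1 / Num.sqrt d%:R :> R.
Proof. by rewrite divr_gt0// mulr_gt0// invr_gt0 exprn_gt0. Qed.

Lemma wasserstein1_le :
  (wasserstein1 G Gs <= (2 ^+ d * delta ^+ d.+1 * Num.sqrt d%:R * t)%:E)%E.
Proof.
have -> : 2 ^+ d * delta ^+ d.+1 * Num.sqrt d%:R =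
    (2 ^- d * delta ^- d.+1 / Num.sqrt d%:R)^-1 :> R.
  by rewrite !invfM !invrK.
by rewrite EFinM lee_pdivlMl.
Qed.

(** The slack in [v] provides an almost optimal coupling directly from the infimum. *)
Lemma coupling_lt (v : R) : 2 ^+ d * delta ^+ d.+1 * Num.sqrt d%:R * t < v ->
  exists2 gam, couplings G Gs gam &
    (\int[gam]_z (enorm (z.1 - z.2))%:E < v%:E)%E.
Proof.
move=> tv; have /ereal_inf_lt[_ [gam gamP <-] gamv] : (wasserstein1 G Gs < v%:E)%E.
  by apply: le_lt_trans wasserstein1_le _; rewrite lte_fin.
by exists gam.
Qed.

(** The box about x stays within [sqrt d] delta of x. If x is at least twice as far from [T], all
    the mass of the box travels at least [sqrt d] delta, and on the level set this mass exceeds (2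
    delta)^d t, too much for the bound on the cost. *)
Lemma level_set_near (x : Rd) (T : set Rd) : closed T -> Gs T = 1%E ->
  level_set delta t G x -> nbd T (2 * Num.sqrt d%:R * delta) x.
Proof.
move=> cT GsT; rewrite /level_set/= convm_box// => tx.
apply: contrapT => far; move: tx; apply/negP; rewrite -leNgt.
have mT := closed_measurable_rV cT.
set r := Num.sqrt d%:R * delta.
have r0 : 0 < r by rewrite mulr_gt0.
set g := fine (G (cbox x delta)).
have Gg : G (cbox x delta) = g%:E.
  by rewrite fineK// fin_num_measure//; exact: measurable_cbox.
have rg : ((r * g)%:E <= wasserstein1 G Gs)%E.
  apply/ereal_infP => _ [gam gamP <-].
  have := @coupling_mass_fst G Gs gam (cbox x delta) T setT r gamP
    (measurable_cbox _ _) mT measurableT GsT (ltW r0).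
  rewrite setCT measure0 mule0 add0e Gg -EFinM; apply => z y zx _ Ty.
  rewrite leNgt; apply/negP => zy; apply: far; exists y => //.
  have : enorm (x - z) <= r.
    by apply: enorm_le_coord => [|i]; [exact: ltW|rewrite !mxE; exact: zx].
  by have := enorm_triangle z x y; rewrite -mulrA -/r; lra.
have := le_trans (lee_wpmul2l _ rg) t_ge.
rewrite lee_fin (ltW k0) => /(_ isT); rewrite -EFinM lee_fin; apply: le_trans.
(* The constants cancel exactly: the factor in [t_ge] times [sqrt d] delta is (2 delta)^-d. *)
rewrite le_eqVlt; apply/orP; left; apply/eqP.
by rewrite /r exprMn invfM exprS invfM; field; rewrite ?gt_eqF ?exprn_gt0.
Qed.

(** If no level point is near y, the cube of half-side 2 r about y has mass at most m/2 under [G].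
    Transport brings less than m/2 from outside that cube, so the ball about y could not have mass m
    under [Gs]. *)
Lemma level_set_dense (T : set Rd) (r m : R) :
  0 < r -> delta < 2 * r ->
  (forall y, T y -> (m%:E <= Gs (eball y r))%E) ->
  2 ^+ d * delta ^+ d.+1 * Num.sqrt d%:R * t < r * (m / 2) ->
  (8 * r) ^+ d * t <= m / 2 ->
  forall y, T y -> exists2 x, level_set delta t G x &
    enorm (x - y) < 4 * Num.sqrt d%:R * r.
Proof.
move=> r0 dr mT /coupling_lt[gam gamP gamv] tm y Ty; apply: contrapT => nox.
have := mT _ Ty; apply/negP; rewrite -ltNge.
apply: (le_lt_trans (coupling_mass_snd y gamP r0)).
(* Every delta-box centred near y misses the level and so has mass at most (2 delta)^d t; as delta <
   2 r, covering the cube by such boxes costs at most (8 r)^d t. *)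
have c1 : (G (cbox y (2 * r)) <= (m / 2)%:E)%E.
  apply: (@le_trans _ _ ((2 * (2 * r) + 2 * delta) ^+ d * t)%:E); last first.
    rewrite lee_fin (le_trans _ tm)// ler_wpM2r ?(ltW t0)//.
    by rewrite lerXn2r ?nnegrE//; move: delta0 dr r0; lra.
  apply: cube_mass_le => //; [by rewrite mulr_gt0|exact: ltW|] => x xy.
  rewrite leNgt; apply/negP => tx; apply: nox; exists x.
    rewrite /level_set/= convm_box//.
    rewrite mulrC ltr_pdivlMr ?exprn_gt0 ?mulr_gt0// mulrC -lte_fin fineK//.
    by rewrite fin_num_measure//; exact: measurable_cbox.
  apply: (@le_lt_trans _ _ (Num.sqrt d%:R * (2 * r + delta))).
    by apply: enorm_le_coord => [|i]; [move: delta0 dr r0; lra|rewrite !mxE; exact: xy].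
  by rewrite -mulrA mulrCA ltr_pM2l//; lra.
have c2 : (r^-1%:E * \int[gam]_z (enorm (z.1 - z.2))%:E < (m / 2)%:E)%E.
  by rewrite lte_pdivrMl// -EFinM.
rewrite [m]splitr EFinD; apply: lee_ltD => //.
by rewrite fin_num_measure//; exact: measurable_cbox.
Qed.

End one_estimate.

End level_sets.

(** * Voronoi cells *)

Section le_integral_nonmeasurable.
Context d (T : measurableType d) (R : realType) (mu : {measure set T -> \bar R}).

(* No measurability is needed, since the integral of a nonnegative function is
   a supremum over the simple functions below it. *)
Lemma ge0_le_integral_nm (f g : T -> \bar R) :
  (forall x, (0 <= f x)%E) -> (forall x, (f x <= g x)%E) ->
  (\int[mu]_x f x <= \int[mu]_x g x)%E.
Proof.
move=> f0 fg; rewrite !ge0_integralE//; last by move=> x _; exact: le_trans (fg x).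
apply: ereal_sup_le => _ [h hf <-]; exists h => //= x.
by apply: le_trans (hf x) _; rewrite !patchT ?inE.
Qed.

End le_integral_nonmeasurable.

Section setdist_theory.
Context (R : realType) (d : nat).
Local Notation Rd := 'rV[R]_d.

Lemma setdist1_le (x z : Rd) (A : set Rd) : A z ->
  (setdist [set x] A <= (enorm (x - z))%:E)%E.
Proof. by move=> Az; apply: ereal_inf_lbound; exists (x, z). Qed.

Lemma setdist1_ge (x : Rd) (A : set Rd) (r : R) :
  (forall z, A z -> r <= enorm (x - z)) -> (r%:E <= setdist [set x] A)%E.
Proof.
move=> Ar; apply/ereal_infP => _ [[a z] [/= -> Az] <-].
by rewrite lee_fin; exact: Ar.
Qed.

(** Distances to sets move by at most the displacement of the point, so half the gap between the two
    distances is a safe radius. This is what makes Voronoi cells closed. *)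
Lemma open_setdist_lt (A B : set Rd) :
  open [set x | (setdist [set x] B < setdist [set x] A)%E].
Proof.
apply/open_enormP => x /= /[dup] xBA /ereal_inf_lt[_ [[_ b] [/= -> Bb] <-] xb].
set r := enorm (x - b) in xb.
(* The distance to [A] is infinite when [A] is empty; any real above r then does. *)
have [r' rr' r'A] : exists2 r' : R, r < r' & (r'%:E <= setdist [set x] A)%E.
  move: xb; case: (setdist [set x] A) => [s| |//].
    by rewrite lte_fin => rs; exists s.
  by move=> _; exists (r + 1); [rewrite ltrDl|rewrite leey].
exists ((r' - r) / 2); first by rewrite divr_gt0 ?subr_gt0.
move=> y xy; apply: (@le_lt_trans _ _ (enorm (y - b))%:E).
  exact: setdist1_le.
apply: (@lt_le_trans _ _ (r' - (r' - r) / 2)%:E).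
  have := enorm_triangle x y b; rewrite (enormB y x) -/r lte_fin; lra.
apply: setdist1_ge => a Aa.
have : r' <= enorm (x - a) by rewrite -lee_fin (le_trans r'A)// setdist1_le.
by have := enorm_triangle y x a; lra.
Qed.

Lemma measurable_voronoi (Theta : set Rd) (N : nat) (Sh : 'I_N -> set Rd) i :
  closed Theta -> measurable (voronoi Theta Sh i).
Proof.
move=> cT; apply: closed_measurable_rV.
rewrite (_ : voronoi Theta Sh i = Theta `&` \bigcap_(j in [set j | j != i])
    ~` [set x | (setdist [set x] (Sh j) < setdist [set x] (Sh i))%E]).
  apply: closedI => //; apply: closed_bigI => j _.
  by apply: open_closedC; exact: open_setdist_lt.
apply/seteqP; split => x [Tx xj]; split => // j ji.
  by move=> /= h; have := le_lt_trans (xj _ ji) h; rewrite ltxx.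
by rewrite leNgt; apply/negP; exact: xj.
Qed.

Section voronoi_cells.
Variables (Theta : set Rd) (N : nat) (L : set Rd) (S Sh : 'I_N -> set Rd).
Variables (eps rho : R) (s : {perm 'I_N}).
Hypotheses (eps0 : 0 < eps) (rho_eps : 8 * eps <= rho).
Hypothesis SL : forall k y, S k y -> exists2 x, L x & enorm (x - y) < eps.
Hypothesis Ssep : forall k j x y, k != j -> S k x -> S j y -> rho <= enorm (x - y).
Hypothesis Shs : forall k, Sh (s k) = L `&` nbd (S k) eps.

Lemma setdist_cluster_le k x y : S k y -> enorm (x - y) < eps ->
  (setdist [set x] (Sh (s k)) <= (2 * eps)%:E)%E.
Proof.
move=> ky xy; have [z Lz zy] := SL ky.
apply: (@le_trans _ _ (enorm (x - z))%:E).
  by apply: setdist1_le; rewrite Shs; split => //; exists y.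
by rewrite lee_fin; have := enorm_triangle y x z; rewrite (enormB y z); lra.
Qed.

Lemma setdist_cluster_ge k j x y : k != j -> S k y -> enorm (x - y) < eps ->
  ((rho - 2 * eps)%:E <= setdist [set x] (Sh (s j)))%E.
Proof.
move=> kj ky xy; apply: setdist1_ge => z; rewrite Shs => -[_ [y' jy' zy']].
have := Ssep kj ky jy'; have := enorm_triangle x y y'.
by have := enorm_triangle z x y'; rewrite (enormB y x); lra.
Qed.

(** The point x is within 2 eps of the cluster of its own component and at least rho - 2 eps away
    from every other cluster, and 2 eps < rho - 2 eps. *)
Lemma voronoi_near k j x y : Theta x -> S j y -> enorm (x - y) < eps ->
  voronoi Theta Sh (s k) x <-> S k y.
Proof.
move=> Tx jy xy.
have e : ((2 * eps)%:E < (rho - 2 * eps)%:E :> \bar R)%E.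
  by rewrite lte_fin; move: eps0 rho_eps; lra.
split=> [[_ xk]|ky].
  have [<-//|jk] := eqVneq j k.
  have := xk (s j); rewrite (inj_eq perm_inj) => /(_ jk) h.
  have := le_trans (setdist_cluster_ge jk jy xy)
    (le_trans h (setdist_cluster_le jy xy)).
  by rewrite leNgt e.
split => // i; rewrite -(permKV s i) (inj_eq perm_inj) => ik.
apply: le_trans (setdist_cluster_le ky xy) _; apply: le_trans (ltW e) _.
by apply: setdist_cluster_ge ky xy; rewrite eq_sym.
Qed.

End voronoi_cells.

End setdist_theory.

(** * Integrals over matched cells *)

Section cell_estimate.
Context (R : realType) (d : nat).
Local Notation Rd := 'rV[R]_d.
Variables (Theta T E Sk : set Rd) (G Gs : probability Rd R).
Variables (gam : probability (Rd * Rd)%type R) (v eps : R).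
Hypotheses (mTheta : measurable Theta) (mT : measurable T).
Hypotheses (mE : measurable E) (mSk : measurable Sk).
Hypotheses (GTheta : G Theta = 1%E) (GsT : Gs T = 1%E) (TTheta : T `<=` Theta).
Hypotheses (gamP : couplings G Gs gam).
Hypothesis gamv : (\int[gam]_z (enorm (z.1 - z.2))%:E < v%:E)%E.
Hypothesis eps0 : 0 < eps.
Hypothesis cell : forall x y, Theta x -> T y -> enorm (x - y) < eps -> (E x <-> Sk y).

Lemma coupling_cost_gt0 : 0 < v.
Proof.
rewrite -lte_fin (le_lt_trans _ gamv)// integral_ge0// => z _.
by rewrite lee_fin enorm_ge0.
Qed.

Lemma integral_cell_eq (H : probability Rd R) (D : set Rd) (f : Rd -> R) :
  (\int[H]_(x in D) (f x)%:E = \int[H]_x (f x * \1_D x)%:E)%E.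
Proof.
by rewrite integral_mkcond epatch_indic; apply: eq_integral => x _.
Qed.

Lemma integral_cell_bound (H : probability Rd R) (D : set Rd) (f : Rd -> R) (Q : R) :
  measurable D -> H Theta = 1%E -> measurable_fun setT f ->
  (forall x, 0 <= f x) -> 0 <= Q -> (forall x, Theta x -> f x <= Q) ->
  exists2 a : R, (\int[H]_(x in D) (f x)%:E = a%:E)%E & 0 <= a <= Q.
Proof.
move=> mD HT mf f0 Q0 fQ; pose I := (\int[H]_(x in D) (f x)%:E)%E.
have I0 : (0 <= I)%E by apply: integral_ge0 => x _; rewrite lee_fin.
have IQ : (I <= Q%:E)%E.
  rewrite /I integral_cell_eq.
  apply: (@le_trans _ _ (\int[H]_x (cst Q%:E x))%E); last first.
    by rewrite integral_cst//= probability_setT mule1.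
  apply: ae_ge0_le_integral => //.
  - by move=> x _; rewrite lee_fin mulr_ge0.
  - by apply/measurable_EFinP; apply: measurable_funM => //; exact: measurable_indic.
  - exists (~` Theta); split; first exact: measurableC.
      by have := probability_setC H mTheta; rewrite HT subee.
    move=> x /= /not_implyP[_ /negP]; rewrite -ltNge lte_fin => fx Tx.
    move: fx; apply/negP; rewrite -leNgt indicE; case: (_ \in _); rewrite ?mulr1 ?mulr0//.
    exact: fQ.
have If : I \is a fin_num.
  by rewrite ge0_fin_numE// (le_lt_trans IQ)// ltry.
exists (fine I); first by rewrite fineK.
by rewrite fine_ge0//= -lee_fin fineK.
Qed.

(** For a transported pair at distance below eps, the two indicators agree and the Lipschitz bound
    applies. For a pair at distance at least eps, the difference is at most Q <= (Q / eps) |x - y|.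
    Integrating against the coupling in both directions concludes. *)
Lemma cell_integral_close (f : Rd -> R) (Q Lf a b : R) :
  measurable_fun setT f -> (forall x, 0 <= f x) -> 0 <= Q -> 0 <= Lf ->
  (forall x, Theta x -> f x <= Q) ->
  (forall x y, Theta x -> Theta y -> `|f x - f y| <= Lf * enorm (x - y)) ->
  (\int[G]_(x in E) (f x)%:E = a%:E)%E ->
  (\int[Gs]_(x in Sk) (f x)%:E = b%:E)%E ->
  `|a - b| <= (Lf + Q / eps) * v.
Proof.
move=> mf f0 Q0 Lf0 fQ fL; rewrite (integral_cell_eq G E) (integral_cell_eq Gs Sk) => Ea Eb.
have k0 : 0 <= Lf + Q / eps by rewrite addr_ge0// divr_ge0// ltW.
have mfD D : measurable D -> measurable_fun setT (fun x => f x * \1_D x).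
  by move=> mD; apply: measurable_funM => //; exact: measurable_indic.
have fD0 D x : 0 <= f x * \1_D x by rewrite mulr_ge0.
have near x y : Theta x -> T y ->
    `|f x * \1_E x - f y * \1_Sk y| <= (Lf + Q / eps) * enorm (x - y).
  move=> Tx Ty; have Thy := TTheta Ty.
  have e0 := enorm_ge0 (x - y).
  have Qe : 0 <= Q / eps by rewrite divr_ge0// ltW.
  have [xy|xy] := ltP (enorm (x - y)) eps.
    have ES : (x \in E) = (y \in Sk).
      by apply/idP/idP; rewrite !inE => ?; apply/(cell Tx Ty xy).
    rewrite !indicE ES; case: (_ \in _); rewrite ?mulr0 ?subrr ?normr0 ?mulr_ge0//.
    rewrite !mulr1 (le_trans (fL _ _ Tx Thy))// ler_wpM2r//.
    by rewrite lerDl.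
  apply: (@le_trans _ _ Q); last first.
    rewrite mulrDl -[leLHS]add0r lerD ?mulr_ge0//.
    by rewrite mulrAC ler_pdivlMr// ler_wpM2l.
  have fE : 0 <= f x * \1_E x <= Q.
    rewrite fD0 indicE; case: (_ \in _); rewrite ?mulr1 ?mulr0//; exact: fQ.
  have fS : 0 <= f y * \1_Sk y <= Q.
    rewrite fD0 indicE; case: (_ \in _); rewrite ?mulr1 ?mulr0//; exact: fQ.
  by move: fE fS => /andP[? ?] /andP[? ?]; rewrite ler_norml; apply/andP; split; lra.
have kv : ((Lf + Q / eps)%:E * \int[gam]_z (enorm (z.1 - z.2))%:E <=
    ((Lf + Q / eps) * v)%:E)%E.
  by rewrite EFinM lee_wpmul2l// ltW.
have h1 := @coupling_le_fst _ _ G Gs gam gamP Theta T (fun x => f x * \1_E x)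
  (fun x => f x * \1_Sk x) (Lf + Q / eps) mTheta mT GTheta GsT (mfD _ mE)
  (mfD _ mSk) (fD0 E) (fD0 Sk) k0.
have h2 := @coupling_le_snd _ _ G Gs gam gamP Theta T (fun x => f x * \1_E x)
  (fun x => f x * \1_Sk x) (Lf + Q / eps) mTheta mT GTheta GsT (mfD _ mE)
  (mfD _ mSk) (fD0 E) (fD0 Sk) k0.
rewrite Ea Eb in h1 h2.
have ab : a <= b + (Lf + Q / eps) * v.
  rewrite -lee_fin EFinD (le_trans (h1 _)) ?leeD2l// => x y Tx Ty.
  by have := near _ _ Tx Ty; rewrite ler_norml => /andP[]; lra.
have ba : b <= a + (Lf + Q / eps) * v.
  rewrite -lee_fin EFinD (le_trans (h2 _)) ?leeD2l// => x y Tx Ty.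
  by have := near _ _ Tx Ty; rewrite ler_norml => /andP[]; lra.
by rewrite ler_norml; apply/andP; split; lra.
Qed.

End cell_estimate.

(** * Component densities *)

Section convm_estimate.
Context (R : realType) (d : nat).
Local Notation Rd := 'rV[R]_d.

Lemma gauss_ge0 (sigma : R) (x : Rd) : 0 <= gauss sigma x.
Proof. by rewrite mulr_ge0 ?expR_ge0// invr_ge0 exprn_ge0 ?sqrtr_ge0. Qed.

Lemma measurable_gauss_sub (sigma : R) (x : Rd) :
  measurable_fun setT (fun th : Rd => gauss sigma (x - th)).
Proof.
apply: measurable_funM => //; apply: measurableT_comp => //.
apply: measurableT_comp => //; apply: measurable_funM => //.
under eq_fun do rewrite enorm_sqr.
apply: measurable_sum => i; apply: measurable_funX.
under eq_fun do rewrite !mxE.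
by apply: measurable_funB => //; exact: measurable_coord.
Qed.

Lemma convm_mcond (sigma : R) (G : probability Rd R) (E : set Rd) (x : Rd) (a l : R) :
  measurable E -> G E = l%:E ->
  (\int[G]_(th in E) (gauss sigma (x - th))%:E = a%:E)%E ->
  convm (gauss sigma) (mcond G E) x = l^-1 * a.
Proof.
move=> mE GE Ea; rewrite /convm ge0_integral_mcond// ?GE ?Ea//.
- by apply/measurable_EFinP; exact: measurable_gauss_sub.
- by move=> th; rewrite lee_fin gauss_ge0.
Qed.

(** The difference splits as l1^-1 (a - b) plus l1^-1 l2^-1 b (l2 - l1), and the lower bounds on the
    weights control the inverses. *)
Lemma ratio_close (a b l1 l2 ka kl Q lam : R) :
  0 < lam -> lam / 2 <= l1 -> lam <= l2 -> 0 <= b <= Q ->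
  `|a - b| <= ka -> `|l1 - l2| <= kl ->
  `|l1^-1 * a - l2^-1 * b| <= 2 / lam * ka + 2 / lam ^+ 2 * (Q * kl).
Proof.
move=> lam0 hl1 hl2 /andP[b0 bQ] ab ll.
have l10 : 0 < l1 by lra.
have l20 : 0 < l2 by lra.
have i1 : l1^-1 <= 2 / lam.
  by rewrite -[2 / lam]invrK lef_pV2 ?posrE ?invr_gt0 ?divr_gt0// invf_div.
have i2 : l2^-1 <= lam^-1 by rewrite lef_pV2 ?posrE.
have -> : l1^-1 * a - l2^-1 * b = l1^-1 * (a - b) + (l1^-1 * l2^-1) * (b * (l2 - l1)).
  by field; rewrite !gt_eqF.
rewrite (le_trans (ler_normD _ _))// lerD// normrM.
  by rewrite (@ger0_norm _ l1^-1) ?invr_ge0 ?(ltW l10)// ler_pM// invr_ge0 ltW.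
have -> : 2 / lam ^+ 2 = (2 / lam) * lam^-1 by field; rewrite gt_eqF.
rewrite (@ger0_norm _ (l1^-1 * l2^-1)) ?mulr_ge0 ?invr_ge0 ?(ltW l10) ?(ltW l20)//.
rewrite ler_pM ?mulr_ge0 ?invr_ge0 ?(ltW l10) ?(ltW l20)//.
  by rewrite ler_pM ?invr_ge0 ?(ltW l10) ?(ltW l20).
by rewrite normrM ler_pM// ?(ger0_norm b0)// distrC.
Qed.

Lemma cell_estimate (Theta T E Sk : set Rd) (G Gs : probability Rd R)
    (gam : probability (Rd * Rd)%type R) (v eps sigma lam L : R) (q : Rd -> R) :
  measurable Theta -> measurable T -> measurable E -> measurable Sk ->
  G Theta = 1%E -> Gs T = 1%E -> T `<=` Theta ->
  couplings G Gs gam ->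
  (\int[gam]_z (enorm (z.1 - z.2))%:E < v%:E)%E ->
  0 < eps ->
  (forall x y, Theta x -> T y -> enorm (x - y) < eps -> (E x <-> Sk y)) ->
  0 <= L -> (forall x, 0 <= q x) -> measurable_fun setT q ->
  (forall x th, Theta th -> gauss sigma (x - th) <= q x) ->
  (forall x th th', Theta th -> Theta th' ->
    `|gauss sigma (x - th) - gauss sigma (x - th')| <= L * q x * enorm (th - th')) ->
  0 < lam -> (lam%:E <= Gs Sk)%E -> v / eps <= lam / 2 ->
  (`|G E - Gs Sk| <= (v / eps)%:E)%E /\
  (l1dist (convm (gauss sigma) (mcond G E)) (convm (gauss sigma) (mcond Gs Sk)) <=
    ((2 / lam * (L + eps^-1) + 2 / lam ^+ 2 / eps) * v)%:E *
    \int[@lebesgue_rV R d]_x (q x)%:E)%E.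
Proof.
move=> mTh mT mE mSk GTh GsT TTh gamP gamv eps0 cell L0 q0 mq gq gL lam0 lamS vlam.
have v0 := coupling_cost_gt0 gamv.
have GsTh : Gs Theta = 1%E.
  apply/eqP; rewrite eq_le probability_le1//= -GsT.
  by apply: le_measure; rewrite ?inE.
have bound := fun H D => @integral_cell_bound R d Theta mTh H D.
have close := @cell_integral_close R d Theta T E Sk G Gs gam v eps mTh mT mE mSk
  GTh GsT TTh gamP gamv eps0 cell.
have one D (H : probability Rd R) : measurable D -> (\int[H]_(x in D) (1 : R)%:E = H D)%E.
  by move=> mD; rewrite integral_cst// mul1e.
have [l1 El1 /andP[l10 l11]] := bound G E (fun=> 1) 1 mE GTh (measurable_cst _)
  (fun=> ler01) ler01 (fun _ _ => lexx _).
have [l2 El2 /andP[l20 l21]] := bound Gs Sk (fun=> 1) 1 mSk GsTh (measurable_cst _)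
  (fun=> ler01) ler01 (fun _ _ => lexx _).
(* The constant function 1, with bound 1 and Lipschitz constant 0, turns the cell integrals into the
   weights. *)
have ll : `|l1 - l2| <= v / eps.
  have := close (fun=> 1) 1 0 l1 l2 (measurable_cst _) (fun=> ler01) ler01 (lexx _)
    (fun _ _ => lexx _).
  rewrite add0r div1r mulrC; apply => // x y _ _.
  by rewrite subrr normr0 mul0r.
rewrite one// in El1; rewrite one// in El2.
split; first by rewrite El1 El2 -EFinB abse_EFin lee_fin.
have lam2 : lam <= l2 by rewrite -lee_fin -El2.
(* The estimated weight differs from one of size at least lam by at most v / eps <= lam / 2, so
   conditioning on the estimated cell does not degenerate. *)
have lam1 : lam / 2 <= l1.
  by move: ll; rewrite ler_norml => /andP[? ?]; lra.
set C := 2 / lam * (L + eps^-1) + 2 / lam ^+ 2 / eps.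
have C0 : 0 <= C.
  by rewrite addr_ge0 ?mulr_ge0 ?addr_ge0 ?invr_ge0 ?exprn_ge0 ?(ltW lam0) ?(ltW eps0).
rewrite -ge0_integralZl//; last 3 first.
- exact/measurable_EFinP.
- by move=> x _; rewrite lee_fin.
- by rewrite lee_fin mulr_ge0// ltW.
apply: ge0_le_integral_nm => x; first by rewrite lee_fin.
rewrite -EFinM lee_fin.
have mg := measurable_gauss_sub sigma x.
have g0 th : 0 <= gauss sigma (x - th) by exact: gauss_ge0.
have [a Ea _] := bound G E _ (q x) mE GTh mg g0 (q0 x) (gq x).
have [b Eb bQ] := bound Gs Sk _ (q x) mSk GsTh mg g0 (q0 x) (gq x).
(* The same estimate at fixed x for the kernel as a function of th: its bound and its Lipschitz
   constant are both multiples of [q x], so the result can be integrated in x. *)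
have ab := close _ (q x) (L * q x) a b mg g0 (q0 x) (mulr_ge0 L0 (q0 x)) (gq x)
  (gL x) Ea Eb.
rewrite (convm_mcond mE El1 Ea) (convm_mcond mSk El2 Eb).
apply: le_trans (ratio_close lam0 lam1 lam2 bQ ab ll) _.
by rewrite le_eqVlt; apply/orP; left; apply/eqP; rewrite /C; field; rewrite !gt_eqF.
Qed.

End convm_estimate.

(** * Convergence *)

Section one_sample_size.
Context (R : realType) (d : nat).
Local Notation Rd := 'rV[R]_d.

Lemma compact_enorm_bounded (A : set Rd) : compact A ->
  exists2 M : R, 0 <= M & forall x, A x -> enorm x <= M.
Proof.
move=> cA.
suff : \forall M \near +oo, A `<=` [set x | enorm x <= M].
  move=> h; near (+oo : set_system R) => M; exists M; last by near: M.
  by near: M; exact: nbhs_pinfty_ge.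
apply: (compact_near_coveringP A).1 => // x Ax.
exists (eball x 1, [set M | enorm x + 1 < M]); [split|] => /=.
- apply: open_nbhs_nbhs; split; first exact: open_eball.
  by rewrite /eball/= subrr enorm0.
- by exists (enorm x + 1); split => //; exact: num_real.
- move=> [y M] /= [/= yx xM]; rewrite /eball/= in yx.
  by have := enormD (y - x) x; rewrite subrK; lra.
Unshelve. all: by end_near. Qed.

Lemma finite_gt0_lb (N : nat) (f : 'I_N -> \bar R) : (forall k, (0 < f k)%E) ->
  exists2 lam : R, 0 < lam & forall k, (lam%:E <= f k)%E.
Proof.
move=> f0.
suff : \forall lam \near (0 : R)^'+, forall k, (lam%:E <= f k)%E.
  move=> h; near (0 : R)^'+ => lam; exists lam; last by near: lam.
  by near: lam; exact: nbhs_right_gt.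
apply: filter_forall => k; have := f0 k; case: (f k) => [r r0|_|//].
  by apply: filterS (nbhs_right_le r0) => lam; rewrite lee_fin.
by apply: nearW => lam; rewrite leey.
Unshelve. all: by end_near. Qed.

Variables (Theta : set Rd) (sigma : R) (Gs : probability Rd R).
Variables (N : nat) (S : 'I_N -> set Rd).
Hypothesis d_gt0 : (0 < d)%N.
Hypothesis cTheta : compact Theta.
Hypothesis sigma0 : 0 < sigma.
Hypothesis GsTheta : Gs Theta = 1%E.
Hypothesis S_comp : set_bij [set: 'I_N] (components (supp Gs)) S.

Definition estimation_error (G : probability Rd R) (Sh : 'I_N -> set Rd)
    (s : {perm 'I_N}) : \bar R :=
  (\big[maxe/0]_(k < N)
     let E := voronoi Theta Sh (s k) in
     maxe `|G E - Gs (S k)|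
          (l1dist (convm (gauss sigma) (mcond G E))
                  (convm (gauss sigma) (mcond Gs (S k)))))%E.

(** [eta] and [C] are built from [Theta], [sigma], [Gs] and [S] alone, before [G], [delta] and [t]
    are introduced, so they serve all sample paths and all sample sizes. *)
Lemma estimation_error_le : exists eta C : R, 0 < eta /\
  forall (G : probability Rd R) (delta t : R) (Sh : 'I_N -> set Rd),
  G Theta = 1%E -> 0 < delta -> 0 < t -> delta < eta -> t < eta ->
  ((2 ^- d * delta ^- d.+1 / Num.sqrt d%:R)%:E * wasserstein1 G Gs <= t%:E)%E ->
  finite_set (components (level_set delta t G)) ->
  ((exists S' : 'I_N -> set Rd, single_linkage (level_set delta t G) S') ->
    single_linkage (level_set delta t G) Sh) ->
  exists s : {perm 'I_N}, (estimation_error G Sh s <= (C * t)%:E)%E.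
Proof.
have hR : hausdorff_space Rd by exact: norm_hausdorff.
have clTheta : closed Theta by exact: compact_closed.
have mTheta := closed_measurable_rV clTheta.
have TTheta : supp Gs `<=` Theta by exact: supp_sub.
have cT : compact (supp Gs).
  by apply: (subclosed_compact _ cTheta) => //; exact: supp_closed.
have mT := closed_measurable_rV (@supp_closed _ _ Gs).
have mS k : measurable (S k).
  by apply: closed_measurable_rV; exact: component_cl S_comp k.
have [M M0 ThM] := compact_enorm_bounded cTheta.
have [q [L L0 [q0 mq Iq gq gL]]] := gauss_envelope d sigma0 M0.
have [rho rho0 Ssep] := components_separated S_comp cT.
have [lam lam0 lamS] := finite_gt0_lb (component_gt0 S_comp).
pose eps := rho / 8.
have eps0 : 0 < eps by rewrite divr_gt0.
have rho_eps : 8 * eps <= rho by rewrite /eps; lra.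
have sd0 : 0 < Num.sqrt d%:R :> R by rewrite sqrtr_gt0 ltr0n.
(* Chosen so that the distance 4 [sqrt d] r in [level_set_dense] is eps. *)
pose r := eps / (4 * Num.sqrt d%:R).
have r0 : 0 < r by rewrite divr_gt0 ?mulr_gt0.
have rE : 4 * Num.sqrt d%:R * r = eps by rewrite /r; field; rewrite gt_eqF.
have [m m0 mball] := supp_eball_unif cT r0.
pose K : R := 2 ^+ d * Num.sqrt d%:R.
have K0 : 0 < K by rewrite mulr_gt0// exprn_gt0.
have [I IE I0] : exists2 I : R,
    (\int[@lebesgue_rV R d]_x (q x)%:E = I%:E)%E & 0 <= I.
  have i0 : (0 <= \int[@lebesgue_rV R d]_x (q x)%:E)%E.
    by apply: integral_ge0 => x _; rewrite lee_fin.
  exists (fine (\int[@lebesgue_rV R d]_x (q x)%:E)); last exact: fine_ge0.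
  by rewrite fineK// ge0_fin_numE.
pose C1 := 2 / lam * (L + eps^-1) + 2 / lam ^+ 2 / eps.
have C10 : 0 <= C1.
  by rewrite addr_ge0 ?mulr_ge0 ?addr_ge0 ?invr_ge0 ?exprn_ge0 ?(ltW lam0) ?(ltW eps0).
pose C := (eps^-1 + C1 * I) * (2 * K).
(* In order: delta^(d+1) <= 1; delta < 2 r; level points within eps of the support; the cost and
   mass conditions of [level_set_dense]; and v / eps <= lam / 2 for the weights. *)
have : exists2 eta : R, 0 < eta & [/\ eta <= 1, eta <= 2 * r,
    2 * Num.sqrt d%:R * eta <= eps, K * eta <= r * (m / 2) &
    (8 * r) ^+ d * eta <= m / 2 /\ 2 * K * eta <= eps * (lam / 2)].
  have bnd (a b : R) : 0 < a -> 0 < b -> \forall e \near (0 : R)^'+, a * e <= b.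
    move=> a0 b0; near=> e; rewrite mulrC -ler_pdivlMr// ltW//.
    by near: e; apply: nbhs_right_lt; rewrite divr_gt0.
  near (0 : R)^'+ => eta; exists eta; first by near: eta; exact: nbhs_right_gt.
  split; last split.
  - by near: eta; apply: nbhs_right_le.
  - by near: eta; apply: nbhs_right_le; rewrite mulr_gt0.
  - by near: eta; apply: bnd => //; rewrite mulr_gt0.
  - by near: eta; apply: bnd => //; rewrite mulr_gt0// divr_gt0.
  - by near: eta; apply: bnd; [rewrite exprn_gt0// mulr_gt0|rewrite divr_gt0].
  - by near: eta; apply: bnd; [rewrite mulr_gt0|rewrite mulr_gt0// divr_gt0].
move=> [eta eta0 [eta1 etar etaeps etaK [etam etalam]]].
exists eta, C; split => // G delta t Sh GTheta delta0 t0 deltaeta teta t_ge Lfin Shlink.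
set Lv := level_set delta t G in Lfin Shlink.
have LS x : Lv x -> exists k, nbd (S k) eps x.
  move=> /(level_set_near d_gt0 delta0 t_ge (@supp_closed _ _ Gs) (supp_full Gs)).
  move=> [y /(component_cover S_comp)[k ky] xy]; exists k; exists y => //.
  apply: lt_le_trans xy _; apply: le_trans etaeps.
  by rewrite ler_pM2l ?mulr_gt0// ltW.
have dK : 2 ^+ d * delta ^+ d.+1 * Num.sqrt d%:R * t <= K * t.
  rewrite ler_wpM2r ?(ltW t0)// mulrAC -/K ler_piMr ?(ltW K0)//.
  by rewrite exprn_ile1 ?(ltW delta0)//; lra.
have SL k y : S k y -> exists2 x, Lv x & enorm (x - y) < eps.
  move=> /(component_sub S_comp) Ty; rewrite -rE.
  apply: (level_set_dense d_gt0 delta0 t0 t_ge r0 _ mball) => //; first lra.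
    apply: le_lt_trans dK _; apply: lt_le_trans etaK.
    by rewrite ltr_pM2l.
  by apply: le_trans etam; rewrite ler_wpM2l ?exprn_ge0 ?mulr_ge0 ?(ltW r0)// ltW.
have Scon := component_conn S_comp.
have S0 := component_nonempty S_comp.
(* [Sh] is only assumed to be a clustering when one with N clusters exists, so existence has to be
   shown first. *)
have [S' S'link] := single_linkage_exists eps0 rho_eps LS SL Ssep Scon S0 Lfin
  (component_count_gt0 S_comp).
have {Shlink}link : single_linkage Lv Sh by apply: Shlink; exists S'.
have [s Shs] := single_linkage_match eps0 rho_eps LS SL Ssep Scon S0 Lfin link.
exists s.
(* The Wasserstein distance is at most K t; the factor 2 gives the strict inequality needed for an
   almost optimal coupling. *)
pose v := 2 * K * t.
have [|gam gamP gamv] := coupling_lt d_gt0 delta0 t_ge (v := v).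
  by apply: le_lt_trans dK _; rewrite /v -mulrA ltr_pMl ?mulr_gt0// ltr1n.
have v0 : 0 < v by rewrite !mulr_gt0.
have vlam : v / eps <= lam / 2.
  rewrite ler_pdivrMr// mulrC; apply: le_trans etalam.
  by rewrite ler_pM2l ?mulr_gt0// ltW.
have CE : C * t = v / eps + C1 * v * I by rewrite /C /v; ring.
have b0 : 0 <= v / eps by rewrite divr_ge0 ?ltW.
have b1 : 0 <= C1 * v * I by exact: mulr_ge0 (mulr_ge0 C10 (ltW v0)) I0.
apply: bigmax_le => [|k _]; first by rewrite CE lee_fin addr_ge0.
have cell x y : Theta x -> supp Gs y -> enorm (x - y) < eps ->
    (voronoi Theta Sh (s k) x <-> S k y).
  move=> Thx /(component_cover S_comp)[j jy] xy.
  exact: (voronoi_near eps0 rho_eps SL Ssep Shs k Thx jy xy).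
have [h1 h2] := cell_estimate mTheta mT (measurable_voronoi Sh (s k) clTheta) (mS k)
  GTheta (supp_full Gs) TTheta gamP gamv eps0 cell L0 q0 mq
  (fun x th Th => gq x th (ThM _ Th))
  (fun x th th' Th Th' => gL x th th' (ThM _ Th) (ThM _ Th')) lam0 (lamS k) vlam.
rewrite /= ge_max; apply/andP; split.
  by apply: le_trans h1 _; rewrite lee_fin CE lerDl.
apply: le_trans h2 _; rewrite -/C1 IE -EFinM lee_fin CE lerDr.
exact: b0.
Unshelve. all: by end_near. Qed.

End one_sample_size.

Theorem theorem4p4 (R : realType) (d : nat) (d_gt0 : (0 < d)%N)
  (Theta : set 'rV[R]_d) (Theta_compact : compact Theta)
  (p0 : 'rV[R]_d -> R) (p0_density : is_density p0)
  (sigma : R) (sigma_gt0 : 0 < sigma)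
  (Gs : probability 'rV[R]_d R) (Gs_proj : is_projection Theta sigma p0 Gs)
  (N : nat) (S : 'I_N -> set 'rV[R]_d)
  (S_comp : set_bij [set: 'I_N] (components (supp Gs)) S)
  (dO : measure_display) (Omega : measurableType dO) (P : probability Omega R)
  (Y : nat -> {RV P >-> 'rV[R]_d}) (Y_iid : iid_sample p0 Y)
  (Gh : nat -> Omega -> probability 'rV[R]_d R)
  (Gh_npmle : {ae P, forall w, forall n, (0 < n)%N ->
     is_npmle Theta sigma (fun i : 'I_n => Y i w) (Gh n w)})
  (delta t : nat -> Omega -> R)
  (delta_gt0 : {ae P, forall w, forall n, (0 < n)%N -> 0 < delta n w})
  (t_gt0 : {ae P, forall w, forall n, (0 < n)%N -> 0 < t n w})
  (delta_to0 : {ae P, forall w, (fun n => delta n w) @ \oo --> (0 : R)})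
  (t_to0 : {ae P, forall w, (fun n => t n w) @ \oo --> (0 : R)})
  (t_ge : {ae P, forall w, forall n, (0 < n)%N ->
     ((2 ^- d * (delta n w) ^- d.+1 / Num.sqrt d%:R)%:E *
       wasserstein1 (Gh n w) Gs <= (t n w)%:E)%E})
  (pieces_finite : {ae P, forall w, forall n, (0 < n)%N ->
     finite_set (components (level_set (delta n w) (t n w) (Gh n w)))})
  (Sh : nat -> Omega -> 'I_N -> set 'rV[R]_d)
  (Sh_clusters : {ae P, forall w, forall n, (0 < n)%N ->
     (exists S' : 'I_N -> set 'rV[R]_d,
        single_linkage (level_set (delta n w) (t n w) (Gh n w)) S') ->
     single_linkage (level_set (delta n w) (t n w) (Gh n w)) (Sh n w)}) :
  {ae P, forall w, exists s : nat -> {perm 'I_N},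
    (fun n => \big[maxe/0]_(k < N)
       let E := voronoi Theta (Sh n w) (s n k) in
       maxe `|Gh n w E - Gs (S k)|
            (l1dist (convm (gauss sigma) (mcond (Gh n w) E))
                    (convm (gauss sigma) (mcond Gs (S k)))))%E
      @ \oo --> (0 : \bar R)%E}.
Proof.
have hR : hausdorff_space 'rV[R]_d by exact: norm_hausdorff.
have [[GsTheta _] _] := Gs_proj.
have [eta [C [eta0 err]]] :=
  estimation_error_le d_gt0 Theta_compact sigma_gt0 GsTheta S_comp.
(* Finitely many almost sure hypotheses are intersected; from here on the sample path is fixed. *)
near=> w.
have h1 : forall n, (0 < n)%N -> Gh n w Theta = 1%E.
  move=> n n0; have : is_npmle Theta sigma (fun i : 'I_n => Y i w) (Gh n w).
    by move: n n0; near: w.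
  by case.
have h2 : forall n, (0 < n)%N -> 0 < delta n w by near: w.
have h3 : forall n, (0 < n)%N -> 0 < t n w by near: w.
have h4 : (fun n => delta n w) @ \oo --> (0 : R) by near: w.
have h5 : (fun n => t n w) @ \oo --> (0 : R) by near: w.
have h6 : forall n, (0 < n)%N ->
     ((2 ^- d * (delta n w) ^- d.+1 / Num.sqrt d%:R)%:E *
       wasserstein1 (Gh n w) Gs <= (t n w)%:E)%E by near: w.
have h7 : forall n, (0 < n)%N ->
     finite_set (components (level_set (delta n w) (t n w) (Gh n w))) by near: w.
have h8 : forall n, (0 < n)%N ->
     (exists S' : 'I_N -> set 'rV[R]_d,
        single_linkage (level_set (delta n w) (t n w) (Gh n w)) S') ->
     single_linkage (level_set (delta n w) (t n w) (Gh n w)) (Sh n w) by near: w.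
(* One labelling per sample size; the identity is the default for n = 0 and while delta or t is not
   yet below [eta]. *)
have /choice[s sP] n : exists s : {perm 'I_N},
    (0 < n)%N -> delta n w < eta -> t n w < eta ->
    (estimation_error Theta sigma Gs S (Gh n w) (Sh n w) s <= (C * t n w)%:E)%E.
  have [[[n0 dn] tn]|nn] := pselect (((0 < n)%N /\ delta n w < eta) /\ t n w < eta).
    have [s sP] := err _ _ _ _ (h1 _ n0) (h2 _ n0) (h3 _ n0) dn tn (h6 _ n0)
      (h7 _ n0) (h8 _ n0).
    by exists s.
  by exists 1%g => n0 dn tn; exfalso; apply: nn.
exists s.
(* The error is squeezed between 0, the base value of the maximum, and C t_n, for all large n. *)
apply: (@squeeze_cvge _ _ _ _ (cst 0%E) _ (fun n => (C * t n w)%:E)).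
- near=> n; apply/andP; split; first exact: bigmax_ge_id.
  apply: sP.
  + by near: n; exact: nbhs_infty_gt.
  + near: n; apply: filterS (cvgr0_norm_lt _ h4 _ eta0) => n; exact: le_lt_trans (ler_norm _).
  + near: n; apply: filterS (cvgr0_norm_lt _ h5 _ eta0) => n; exact: le_lt_trans (ler_norm _).
- exact: cvg_cst.
- apply: cvg_EFin; first exact: nearW.
  rewrite -(mulr0 C); apply: cvgM => //; exact: cvg_cst.
Unshelve. all: by end_near. Qed.
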